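(* Let $E$ be a finite acyclic directed graph and let $k$ be a positive integer. Let $\mathbb{Z}/k$ act on $C^*(E)$ by the restriction of the gauge action. Then the following are equivalent: (a) $\mathrm{dim}^{\mathbb{Z}/k}_{\mathrm{SLT}}(C^*(E))$ is finite; (b) $\mathrm{dim}^{\mathbb{Z}/k}_{\mathrm{LT}}(C^*(E))$ is finite; (c) for each sink $v$ of $E$, the number $\#^v_i$ is independent of $i\in\{0,\ldots,k-1\}$; (d) $\mathrm{dim}^{\mathbb{Z}/k}_{\mathrm{LT}}(C^*(E)) = 0$.
   Context: A directed graph is $E=(E^0,E^1,r,s)$ with vertex set $E^0$, edge set $E^1$, and range and source maps $r,s:E^1\to E^0$; finite means $E^0$ and $E^1$ are finite; loops and multiple edges are allowed in general. A sink is a vertex emitting no edges. A path of length $m\ge 1$ is a sequence of edges $e_1\cdots e_m$ with $r(e_j)=s(e_{j+1})$; paths of length $0$ are the vertices. $C^*(E)$ is the universal $C^*$-algebra generated by mutually orthogonal projections $P_v$ ($v\in E^0$) and partial isometries $S_e$ ($e\in E^1$) with mutually orthogonal ranges such that $S_e^*S_e=P_{r(e)}$, $S_eS_e^*\le P_{s(e)}$, and $P_v=\sum_{e\in s^{-1}(v)}S_eS_e^*$ whenever $s^{-1}(v)$ is nonempty and finite. The gauge action of $\mathbb{S}^1$ is $S_e\mapsto\lambda S_e$, $P_v\mapsto P_v$ for $\lambda\in\mathbb{S}^1$; $\mathbb{Z}/k$ is identified with the $k$th roots of unity in $\mathbb{S}^1$. For a sink $v$ and a residue $i\in\{0,\ldots,k-1\}$,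 $\#^v_i$ is the number of directed paths in $E$ (including the length-$0$ path $v$) that end at $v$ and have length congruent to $i$ modulo $k$. Local-triviality dimensions: let a compact group $G$ act on a unital $C^*$-algebra $A$. Equip $C(G)$ with $(\alpha_gf)(h)=f(hg)$ and $C_0((0,1])\otimes C(G)$ with the action on the second factor, and let $t$ be the identity function in $C_0((0,1])$. $\mathrm{dim}^G_{\mathrm{LT}}(A)$ is the smallest $n\ge0$ for which there exist $G$-equivariant $*$-homomorphisms $\rho_0,\ldots,\rho_n:C_0((0,1])\otimes C(G)\to A$ with $\sum_{i=0}^n\rho_i(t\otimes1)=1$. $\mathrm{dim}^G_{\mathrm{SLT}}(A)$ is the smallest $n\ge 0$ for which there is a $G$-equivariant unital $*$-homomorphism $C(E_nG)\to A$, where $E_0G=G$, $E_{n+1}G=E_nG*G$ (topological join) with the diagonal action of $G$. If no such $n$ exists, the dimension is $\infty$. *)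

(* Defs.v *)
From HB Require Import structures.
From mathcomp Require Import all_boot all_order all_algebra.
From mathcomp Require Import finmap.
From mathcomp Require Import all_classical all_reals all_analysis.
From mathcomp Require Import complex.
Import numFieldNormedType.Exports.
Import Order.TTheory GRing.Theory Num.Theory.

Set Implicit Arguments.
Unset Strict Implicit.
Unset Printing Implicit Defensive.

Local Open Scope classical_set_scope.
Local Open Scope ring_scope.

(* R[i] packaged as a numClosedFieldType, so that it inherits the generic
   normed-module structure of such a field over itself. *)
Definition Cplx (R : realType) : numClosedFieldType := complex R.
Arguments Cplx : simpl never.

Definition toCplx (R : realType) (x : R) : Cplx R := real_complex R x.

Lemma toCplx_continuous (R : realType) : continuous (@toCplx R).
Proof.
move=> x; apply/cvgrPdist_lt => e e0.
have ee : e = real_complex R (complex.Re e) by rewrite RRe_real// gtr0_real.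
have re0 : 0 < complex.Re e by move: e0; rewrite {1}ee ltcR.
near=> y.
rewrite /toCplx -(rmorphB (real_complex R)) /= {1}ee.
have -> : `|real_complex R (x - y) : Cplx R| = real_complex R `|x - y|.
  by rewrite normc_def/= expr0n/= addr0 sqrtr_sqr.
rewrite ltcR; near: y.
by apply: cvgr_dist_lt => //; exact: cvg_id.
Unshelve. all: by end_near.
Qed.

Lemma pair_fun_continuous (X Y Z : topologicalType) (f : X -> Y) (g : X -> Z) :
  continuous f -> continuous g -> continuous (fun x => (f x, g x)).
Proof. by move=> fc gc x; apply: cvg_pair => /=; [exact: fc|exact: gc]. Qed.

(* Algebras need not be unital: the multiplication is not the one of a ring
   structure. *)
HB.mixin Record isStarAlgebra (K : numClosedFieldType) A
    of GRing.Lmodule K A := {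
  amul : A -> A -> A;
  star : A -> A;
  amulA : associative amul;
  amulDl : left_distributive amul +%R;
  amulDr : right_distributive amul +%R;
  amulZl : forall (c : K) x y, amul (c *: x) y = c *: amul x y;
  amulZr : forall (c : K) x y, amul x (c *: y) = c *: amul x y;
  starK : involutive star;
  starD : {morph star : x y / x + y};
  starZ : forall (c : K) x, star (c *: x) = c^* *: star x;
  starM : forall x y, star (amul x y) = amul (star y) (star x)
}.

#[short(type="starAlgType")]
HB.structure Definition StarAlgebra (K : numClosedFieldType) :=
  {A of isStarAlgebra K A & GRing.Lmodule K A}.

Notation "x ** y" := (amul x y) (at level 40, left associativity) : ring_scope.

HB.mixin Record isCStarAlgebra (K : numClosedFieldType) A
    of CompleteNormedModule K A & StarAlgebra K A := {
  norm_amul : forall x y : A, `|x ** y| <= `|x| * `|y|;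
  cstar_identity : forall x : A, `|star x ** x| = `|x| ^+ 2
}.

#[short(type="cstarAlgType")]
HB.structure Definition CStarAlgebra (K : numClosedFieldType) :=
  {A of isCStarAlgebra K A & CompleteNormedModule K A & StarAlgebra K A}.

Record star_hom (K : numClosedFieldType) (A B : starAlgType K) (f : A -> B) :
  Prop := StarHom {
  star_hom_linear : linear f;
  star_homM : {morph f : x y / x ** y};
  star_hom_star : {morph f : x / star x} }.

Definition is_one (K : numClosedFieldType) (A : starAlgType K) (u : A) : Prop :=
  forall a, u ** a = a /\ a ** u = a.

Definition projection (K : numClosedFieldType) (A : starAlgType K) (p : A) :
  Prop := star p = p /\ p ** p = p.

Definition partial_isometry (K : numClosedFieldType) (A : starAlgType K)
  (s : A) : Prop := s ** star s ** s = s.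

(* The order of a C*-algebra: a <= b iff b - a is of the form c^* c. *)
Definition cstar_le (K : numClosedFieldType) (A : cstarAlgType K) (a b : A) :
  Prop := exists c : A, b - a = star c ** c.

(* C(X) for compact X, as a *-algebra; *-homomorphisms are purely algebraic, so
   its norm is not needed. *)
Section ContinuousFunctions.
Variables (K : numClosedFieldType) (X : topologicalType).

Definition cfun_pred : {pred (X -> K)} := fun f => `[< continuous f >].

Record cfun := Cfun { cfun_val :> X -> K; _ : cfun_val \in cfun_pred }.
HB.instance Definition _ := [isSub for cfun_val].
HB.instance Definition _ := [Choice of cfun by <:].

Lemma cfunP (f : cfun) : continuous f.
Proof. exact/asboolP/(valP f). Qed.

Lemma cfun_submod : submod_closed cfun_pred.
Proof.
split=> [|a f g /asboolP fc /asboolP gc]; apply/asboolP => x.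
  exact: cst_continuous.
by apply: cvgD; [apply: cvgZr; exact: fc|exact: gc].
Qed.
HB.instance Definition _ :=
  GRing.SubChoice_isSubLmodule.Build K (X -> K) cfun_pred cfun cfun_submod.

Lemma cfun_linE (a : K) (f g : cfun) x : (a *: f + g) x = a * f x + g x.
Proof. by []. Qed.

Definition mk_cfun (f : X -> K) (fc : continuous f) : cfun :=
  @Cfun f (introT (asboolP _) fc).

Lemma cfun_mul_subproof (f g : cfun) : continuous (fun x => f x * g x).
Proof. by move=> x; apply: cvgM; exact: cfunP. Qed.

Lemma cfun_star_subproof (f : cfun) : continuous (fun x => (f x)^*).
Proof.
move=> x; apply/cvgrPdist_lt => e e0.
near=> y; rewrite -rmorphB norm_conjC; near: y.
by apply: cvgr_dist_lt => //; exact: cfunP.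
Unshelve. all: by end_near.
Qed.

Definition cfun_mul (f g : cfun) : cfun := mk_cfun (@cfun_mul_subproof f g).
Definition cfun_star (f : cfun) : cfun := mk_cfun (@cfun_star_subproof f).

Lemma cfun_eqP (f g : cfun) : f =1 g -> f = g.
Proof. by move=> fg; apply/val_inj/funext. Qed.

Program Definition cfun_starMixin :=
  @isStarAlgebra.Build K cfun cfun_mul cfun_star _ _ _ _ _ _ _ _ _.
Next Obligation. by move=> f g h; apply: cfun_eqP => x /=; rewrite mulrA. Qed.
Next Obligation. by move=> f g h; apply: cfun_eqP => x /=; rewrite mulrDl. Qed.
Next Obligation. by move=> f g h; apply: cfun_eqP => x /=; rewrite mulrDr. Qed.
Next Obligation. by move=> *; apply: cfun_eqP => z /=; rewrite -scalerAl. Qed.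
Next Obligation. by move=> *; apply: cfun_eqP => z /=; rewrite -scalerAr. Qed.
Next Obligation. by move=> f; apply: cfun_eqP => x /=; rewrite conjCK. Qed.
Next Obligation. by move=> f g; apply: cfun_eqP => x /=; rewrite rmorphD. Qed.
Next Obligation. by move=> *; apply: cfun_eqP => z /=; rewrite rmorphM. Qed.
Next Obligation. by move=> *; apply: cfun_eqP => z /=; rewrite rmorphM mulrC. Qed.
HB.instance Definition _ := cfun_starMixin.

Definition cfun1 : cfun := mk_cfun (fun x => @cst_continuous X K 1 x).

End ContinuousFunctions.

Definition unitI (R : realType) : topologicalType := [set` `[0 : R, 1]].

(* C_0((0,1]) (x) C(X) for compact X, as the *-algebra of the continuous
   functions on [0,1] * X that vanish on {0} * X; the elementary tensor f (x) h
   is the function (s, x) |-> f s * h x. *)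
Section Cone.
Variables (R : realType) (K : numClosedFieldType) (X : topologicalType).
Local Notation base := (cfun K (unitI R * X)%type).

Definition cone_pred : {pred base} :=
  fun f => `[< forall s x, val s = 0 -> f (s, x) = 0 >].

Record cone := Cone { cone_val :> base; _ : cone_val \in cone_pred }.
HB.instance Definition _ := [isSub for cone_val].
HB.instance Definition _ := [Choice of cone by <:].

Lemma coneP (f : cone) s x : val s = 0 -> f (s, x) = 0.
Proof. by move/asboolP: (valP f); apply. Qed.

Lemma cone_submod : submod_closed cone_pred.
Proof.
split=> [|a f g /asboolP f0 /asboolP g0]; apply/asboolP => s x s0 //.
by rewrite cfun_linE (f0 s x s0) (g0 s x s0) mulr0 addr0.
Qed.
HB.instance Definition _ :=
  GRing.SubChoice_isSubLmodule.Build K base cone_pred cone cone_submod.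

Definition mk_cone (f : base) (f0 : forall s x, val s = 0 -> f (s, x) = 0) :
  cone := @Cone f (introT (asboolP _) f0).

Lemma cone_mul_subproof (f g : cone) s x :
  val s = 0 -> ((f : base) ** g) (s, x) = 0.
Proof. by move=> s0 /=; rewrite coneP// mul0r. Qed.

Lemma cone_star_subproof (f : cone) s x :
  val s = 0 -> (star (f : base)) (s, x) = 0.
Proof. by move=> s0 /=; rewrite coneP// conjC0. Qed.

Definition cone_mul (f g : cone) : cone := mk_cone (@cone_mul_subproof f g).
Definition cone_star (f : cone) : cone := mk_cone (@cone_star_subproof f).

Program Definition cone_starMixin :=
  @isStarAlgebra.Build K cone cone_mul cone_star _ _ _ _ _ _ _ _ _.
Next Obligation. by move=> *; apply: val_inj; apply: amulA. Qed.
Next Obligation. by move=> *; apply: val_inj; apply: amulDl. Qed.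
Next Obligation. by move=> *; apply: val_inj; apply: amulDr. Qed.
Next Obligation. by move=> *; apply: val_inj; apply: amulZl. Qed.
Next Obligation. by move=> *; apply: val_inj; apply: amulZr. Qed.
Next Obligation. by move=> *; apply: val_inj; apply: starK. Qed.
Next Obligation. by move=> *; apply: val_inj; apply: starD. Qed.
Next Obligation. by move=> *; apply: val_inj; apply: starZ. Qed.
Next Obligation. by move=> *; apply: val_inj; apply: starM. Qed.
HB.instance Definition _ := cone_starMixin.

End Cone.

Section ConeCoordinate.
Variables (R : realType) (X : topologicalType).

Lemma cone_t_continuous :
  continuous (fun p : unitI R * X => toCplx (val p.1)).
Proof.
move=> p; apply: (@continuous_comp _ _ _ (fun p : unitI R * X => val p.1)).
  apply: (@continuous_comp _ _ _ fst (val : unitI R -> R)).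
    exact: cvg_fst.
  exact: initial_continuous.
exact: toCplx_continuous.
Qed.

Lemma cone_t_subproof s x :
  val s = 0 -> mk_cfun cone_t_continuous (s, x) = 0.
Proof. by move=> /= ->; rewrite /toCplx raddf0. Qed.

(* t (x) 1 *)
Definition cone_t : cone R (Cplx R) X := mk_cone cone_t_subproof.

End ConeCoordinate.

HB.mixin Record isTopologicalGroup G of Topological G & Group G := {
  mulg_continuous : continuous (fun p : G * G => (p.1 * p.2)%g);
  invg_continuous : continuous (fun x : G => x^-1%g)
}.

#[short(type="topGroupType")]
HB.structure Definition TopologicalGroup :=
  {G of isTopologicalGroup G & Topological G & Group G}.

Record cstar_action (K : numClosedFieldType) (G : topGroupType)
  (A : cstarAlgType K) (alpha : G -> A -> A) : Prop := CStarAction {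
  action_hom : forall g, star_hom (alpha g);
  action1 : forall a, alpha 1%g a = a;
  actionM : forall g h a, alpha (g * h)%g a = alpha g (alpha h a);
  action_continuous : forall a, continuous (alpha ^~ a) }.

(* Right G-spaces; only the continuity of each translation is recorded. *)
Record rightSpace (G : topGroupType) := RightSpace {
  space :> topologicalType;
  ract : space -> G -> space;
  ract1 : forall x, ract x 1%g = x;
  ractM : forall x g h, ract x (g * h)%g = ract (ract x g) h;
  ract_continuous : forall g, continuous (ract ^~ g) }.

Section RightSpaces.
Variables (R : realType) (K : numClosedFieldType) (G : topGroupType).

Lemma mulgr_continuous (g : G) : continuous (fun x : G => x * g)%g.
Proof.
move=> x; apply: (@continuous_comp _ _ _ (fun x : G => (x, g))
  (fun p : G * G => (p.1 * p.2)%g)); last exact: mulg_continuous.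
by apply: pair_fun_continuous => y; [exact: cvg_id|exact: cst_continuous].
Qed.

Definition translation_space : rightSpace G :=
  @RightSpace G G (fun x g => x * g)%g (@mulg1 G) (@mulgA G) mulgr_continuous.

(* (alpha_g f)(x) = f(xg) on C(X). *)
Section Translate.
Variable X : rightSpace G.
Lemma translate_continuous (g : G) (f : cfun K X) :
  continuous (fun x : X => f (ract x g)).
Proof.
move=> x; apply: (@continuous_comp _ _ _ (fun x : X => ract x g)).
  exact: ract_continuous.
exact: cfunP.
Qed.
Definition translate (g : G) (f : cfun K X) : cfun K X :=
  mk_cfun (@translate_continuous g f).
End Translate.

Lemma cone_translate_continuous (g : G) (f : cone R K G) :
  continuous (fun p : unitI R * G => f (p.1, (p.2 * g)%g)).
Proof.
move=> p; apply: (@continuous_comp _ _ _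
  (fun p : unitI R * G => (p.1, (p.2 * g)%g))); last exact: cfunP.
apply: pair_fun_continuous => [q|q]; first exact: cvg_fst.
apply: (@continuous_comp _ _ _ snd (fun x : G => x * g)%g).
  exact: cvg_snd.
exact: mulgr_continuous.
Qed.

Lemma cone_translate_subproof (g : G) (f : cone R K G) s x : val s = 0 ->
  mk_cfun (@cone_translate_continuous g f) (s, x) = 0.
Proof. by move=> s0; rewrite /= coneP. Qed.

(* The action of G on the second factor of C_0((0,1]) (x) C(G). *)
Definition cone_translate (g : G) (f : cone R K G) : cone R K G :=
  mk_cone (@cone_translate_subproof g f).

Section Join.
Variables X Y : rightSpace G.
Local Notation T := (X * Y * unitI R)%type.
Local Open Scope quotient_scope.

Definition join_rel : rel T := fun p q =>
  [&& p.2 == q.2, (val p.2 == 1) || (p.1.1 == q.1.1)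
    & (val p.2 == 0) || (p.1.2 == q.1.2)].

Lemma join_relP : equiv_class_of join_rel.
Proof.
split=> [[[x y] s]|[[x y] s] [[x' y'] s']|[[x y] s] [[x' y'] s'] [[x'' y''] s'']].
- by rewrite /join_rel/= !eqxx !orbT.
- by rewrite /join_rel/= (eq_sym s) (eq_sym x) (eq_sym y); case: eqVneq => //= ->.
- rewrite /join_rel/= => /and3P[/eqP -> hx hy] /and3P[/eqP ss hx' hy'].
  apply/and3P; split; first exact/eqP.
    by case/orP: hx' => [->//|/eqP <-].
  by case/orP: hy' => [->//|/eqP <-].
Qed.

Canonical join_equiv := EquivRelPack join_relP.

(* X * Y * [0,1] / (x,y,0) ~ (x,y',0), (x,y,1) ~ (x',y,1) *)
Definition join : topologicalType := quotient_topology {eq_quot join_rel}.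

Definition join_act0 (p : T) (g : G) : T :=
  (ract p.1.1 g, ract p.1.2 g, p.2).

Definition join_act (q : join) (g : G) : join :=
  \pi_join (join_act0 (repr q) g).

Lemma join_act0_rel p q g :
  \pi_join p == \pi_join q -> \pi_join (join_act0 p g) == \pi_join (join_act0 q g).
Proof.
move=> /eqP /(@eqmodP _ join_equiv) /and3P[h hx hy].
apply/eqP/(@eqmodP _ join_equiv)/and3P; split => //=.
  by case/orP: hx => [->//|/eqP ->]; rewrite eqxx orbT.
by case/orP: hy => [->//|/eqP ->]; rewrite eqxx orbT.
Qed.

Lemma join_actE p g : join_act (\pi_join p) g = \pi_join (join_act0 p g).
Proof. by apply/eqP/join_act0_rel; rewrite reprK. Qed.

Lemma join_act1 q : join_act q 1%g = q.
Proof.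
by rewrite /join_act /join_act0 !ract1 -!surjective_pairing reprK.
Qed.

Lemma join_actM q g h : join_act q (g * h)%g = join_act (join_act q g) h.
Proof.
by rewrite [join_act q g]/join_act join_actE /join_act /join_act0 /= !ractM.
Qed.

Lemma join_act_continuous g : continuous (join_act ^~ g).
Proof.
apply: (@repr_comp_continuous _ {eq_quot join_rel} _
  (fun p => \pi_join (join_act0 p g))); last by move=> a b; exact: join_act0_rel.
move=> p; apply: (@continuous_comp _ _ _ (fun p => join_act0 p g)).
  apply: pair_fun_continuous => [{}p|{}p]; last exact: cvg_snd.
  apply: pair_fun_continuous => {}p.
    apply: (@continuous_comp _ _ _ (fun p : T => p.1.1)
      (ract (r := X) ^~ g)).
      by apply: continuous_comp; exact: cvg_fst.
    exact: ract_continuous.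
  apply: (@continuous_comp _ _ _ (fun p : T => p.1.2)
    (ract (r := Y) ^~ g)).
    by apply: continuous_comp; [exact: cvg_fst|exact: cvg_snd].
  exact: ract_continuous.
exact: (@pi_continuous _ {eq_quot join_rel}).
Qed.

Definition join_space : rightSpace G :=
  RightSpace join_act1 join_actM join_act_continuous.

End Join.

Fixpoint EG (n : nat) : rightSpace G :=
  if n is m.+1 then join_space (EG m) translation_space else translation_space.

End RightSpaces.

Section Dimensions.
Variables (R : realType) (G : topGroupType) (A : cstarAlgType (Cplx R)).
Variable alpha : G -> A -> A.

Definition LT_bound (n : nat) : Prop :=
  exists rho : 'I_n.+1 -> cone R (Cplx R) G -> A,
    [/\ forall i, star_hom (rho i),
        forall i g f, rho i (cone_translate g f) = alpha g (rho i f)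
      & is_one (\sum_(i < n.+1) rho i (cone_t R G))].

Definition SLT_bound (n : nat) : Prop :=
  exists phi : cfun (Cplx R) (EG R G n) -> A,
    [/\ star_hom phi,
        forall g f, phi (translate g f) = alpha g (phi f)
      & is_one (phi (cfun1 (Cplx R) (EG R G n)))].

End Dimensions.

(* The smallest n such that P n, or None (= infinity) if there is none. *)
Definition least (P : nat -> Prop) : option nat :=
  match pselect (exists n, `[< P n >]) with
  | left exP => Some (ex_minn exP)
  | right _ => None
  end.

Definition dimLT (R : realType) (G : topGroupType) (A : cstarAlgType (Cplx R))
  (alpha : G -> A -> A) : option nat := least (LT_bound alpha).

Definition dimSLT (R : realType) (G : topGroupType) (A : cstarAlgType (Cplx R))
  (alpha : G -> A -> A) : option nat := least (SLT_bound alpha).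

Section Circle.
Variable K : numClosedFieldType.

Record circle := Circle { circle_val :> K; _ : `|circle_val| == 1 }.
HB.instance Definition _ := [isSub for circle_val].
HB.instance Definition _ := [Choice of circle by <:].
HB.instance Definition _ :=
  Topological.copy circle (initial_topology (circle_val : circle -> K)).

Lemma circle_norm (z : circle) : `|z : K| = 1.
Proof. exact/eqP/(valP z). Qed.

Lemma circle_neq0 (z : circle) : (z : K) != 0.
Proof. by rewrite -normr_eq0 circle_norm oner_eq0. Qed.

Lemma circle1_subproof : `|1 : K| == 1. Proof. by rewrite normr1. Qed.
Lemma circleM_subproof (z w : circle) : `|(z : K) * (w : K)| == 1.
Proof. by rewrite normrM !circle_norm mulr1. Qed.
Lemma circleV_subproof (z : circle) : `|(z : K)^-1| == 1.
Proof. by rewrite normfV circle_norm invr1. Qed.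

Program Definition circle_groupMixin := @isGroup.Build circle
  (Circle circle1_subproof) (fun z => Circle (circleV_subproof z))
  (fun z w => Circle (circleM_subproof z w)) _ _ _ _ _.
Next Obligation. by move=> x y z; apply: val_inj; rewrite /= mulrA. Qed.
Next Obligation. by move=> x; apply: val_inj; rewrite /= mul1r. Qed.
Next Obligation. by move=> x; apply: val_inj; rewrite /= mulr1. Qed.
Next Obligation.
by move=> x; apply: val_inj; rewrite /= mulVf// circle_neq0.
Qed.
Next Obligation.
by move=> x; apply: val_inj; rewrite /= mulfV// circle_neq0.
Qed.
HB.instance Definition _ := circle_groupMixin.

Lemma circle_val_continuous : continuous circle_val.
Proof. exact: initial_continuous. Qed.

Lemma circle_mul_continuous :
  continuous (fun p : circle * circle => (p.1 * p.2)%g).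
Proof.
apply: continuous_comp_initial => p; apply: cvgM.
  by apply: (@continuous_comp _ _ _ fst circle_val);
    [exact: cvg_fst|exact: circle_val_continuous].
by apply: (@continuous_comp _ _ _ snd circle_val);
  [exact: cvg_snd|exact: circle_val_continuous].
Qed.

Lemma circle_inv_continuous : continuous (fun z : circle => z^-1%g).
Proof.
apply: continuous_comp_initial => z; apply: (@continuous_comp _ _ _ circle_val (@GRing.inv K)).
  exact: circle_val_continuous.
exact/inv_continuous/circle_neq0.
Qed.

HB.instance Definition _ := isTopologicalGroup.Build circle
  circle_mul_continuous circle_inv_continuous.

End Circle.

(* Z/k, as the group of k-th roots of unity in the circle (for k > 0). *)
Section RootsOfUnity.
Variables (K : numClosedFieldType) (k : nat).

Definition unity_pred : {pred circle K} := fun z => (z ^+ k == 1)%g.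

Record unity := Unity { unity_val :> circle K; _ : unity_val \in unity_pred }.
HB.instance Definition _ := [isSub for unity_val].
HB.instance Definition _ := [Choice of unity by <:].
HB.instance Definition _ :=
  Topological.copy unity (initial_topology (unity_val : unity -> circle K)).

Lemma circle_mulC (z w : circle K) : (z * w = w * z)%g.
Proof. by apply: val_inj; rewrite /= mulrC. Qed.

Lemma unity_closed : group_closed unity_pred.
Proof.
split=> [|z w /eqP zk /eqP wk]; rewrite unfold_in /=; first by rewrite expg1n.
by rewrite expgMn ?expVgn ?zk ?wk ?invg1 ?mulg1//; exact: circle_mulC.
Qed.
HB.instance Definition _ :=
  SubChoice_isSubGroup.Build (circle K) unity_pred unity unity_closed.

Lemma unity_val_continuous : continuous unity_val.
Proof. exact: initial_continuous. Qed.

Lemma unity_mul_continuous :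
  continuous (fun p : unity * unity => (p.1 * p.2)%g).
Proof.
apply: continuous_comp_initial => p.
rewrite (_ : _ \o _ = (fun q : circle K * circle K => (q.1 * q.2)%g) \o
  (fun p => (unity_val p.1, unity_val p.2))); last by apply/funext.
apply: continuous_comp; last exact: mulg_continuous.
apply: pair_fun_continuous => q.
  by apply: (@continuous_comp _ _ _ fst unity_val);
    [exact: cvg_fst|exact: unity_val_continuous].
by apply: (@continuous_comp _ _ _ snd unity_val);
  [exact: cvg_snd|exact: unity_val_continuous].
Qed.

Lemma unity_inv_continuous : continuous (fun z : unity => z^-1%g).
Proof.
apply: continuous_comp_initial => z.
apply: (@continuous_comp _ _ _ unity_val (fun z : circle K => z^-1%g)).
  exact: unity_val_continuous.
exact: invg_continuous.
Qed.

HB.instance Definition _ := isTopologicalGroup.Build unity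
  unity_mul_continuous unity_inv_continuous.

Lemma unity_compact : (0 < k)%N -> compact [set: unity].
Proof.
move=> k_gt0; apply: finite_compact.
have [r rE] := closed_field_poly_normal ('X^k - 1 : {poly K}).
pose f (z : unity) : K := circle_val (unity_val z).
have fin : finite_set (f @^-1` [set` r]).
  apply: finite_preimage; last exact: finite_seq.
  by move=> x y _ _ /val_inj/val_inj.
apply: sub_finite_set fin => z _ /=.
have zk : f z ^+ k = 1.
  have /eqP/(congr1 (@circle_val K)) : (unity_val z ^+ k == 1)%g := valP z.
  move=> /= <-; elim: (k) => [|n IHn] //.
  by rewrite exprS expgS IHn.
have : root ('X^k - 1) (f z) by rewrite rootE !hornerE zk subrr.
by rewrite rE (monicP (monicXnsubC 1 k_gt0)) scale1r root_prod_XsubC.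
Qed.

End RootsOfUnity.

Record digraph := Digraph {
  vertex : finType;
  edge : finType;
  src : edge -> vertex;
  rng : edge -> vertex }.

Section Graph.
Variable E : digraph.

Definition sink (v : vertex E) : Prop := forall e : edge E, src e != v.

(* (u, [:: e_1; ...; e_m]) is the path e_1 ... e_m from u; the paths of length
   0 are the pairs (u, [::]). *)
Definition is_path (p : vertex E * seq (edge E)) : bool :=
  if p.2 is e :: s
  then (src e == p.1) && path (fun e f => rng e == src f) e s
  else true.

Definition path_end (p : vertex E * seq (edge E)) : vertex E :=
  last p.1 (map (@rng E) p.2).

Definition acyclic : Prop :=
  forall p, is_path p -> (0 < size p.2)%N -> path_end p != p.1.

Definition paths_mod (k : nat) (v : vertex E) (i : nat) :
  set (vertex E * seq (edge E)) :=
  [set p | [/\ is_path p, path_end p = v & size p.2 = i %[mod k]]].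

Lemma acyclic_uniq p : acyclic -> is_path p -> uniq p.2.
Proof.
case: p => u s acE; elim: s u => [//|e s IHs] u /andP[_ es] /=.
apply/andP; split; last first.
  apply: (IHs (rng e)); case: s es {IHs} => //= f s /andP[/eqP ef fs].
  by rewrite /is_path /= -ef eqxx.
apply/negP => /splitPr es'; case: s / es' es {IHs} => s1 s2.
rewrite cat_path => /and3P[es1 /eqP h _].
have := acE (src e, e :: s1); rewrite /is_path /path_end /= eqxx es1.
by rewrite last_map h eqxx => /(_ isT isT).
Qed.

Lemma finite_paths_mod k v i : acyclic -> finite_set (paths_mod k v i).
Proof.
move=> acE; pose F (q : vertex E * {n : 'I_#|edge E|.+1 & n.-tuple (edge E)}) :=
  (q.1, tval (tagged q.2)).
apply: (@sub_finite_set _ _ (range F)); last first.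
  by apply: finite_image; exact: finite_finset.
move=> [u s] [ps _ _].
have sz : (size s < #|edge E|.+1)%N.
  by rewrite ltnS -(card_uniqP (acyclic_uniq acE ps)) max_card.
by exists (u, Tagged (fun n : 'I_#|edge E|.+1 => n.-tuple (edge E))
  (in_tuple s : (Ordinal sz).-tuple (edge E))).
Qed.

(* A genuine number when E is acyclic, by finite_paths_mod. *)
Definition num_paths (k : nat) (v : vertex E) (i : nat) : nat :=
  #|` fset_set (paths_mod k v i) |%fset.

End Graph.

Section GraphAlgebra.
Variables (R : realType) (E : digraph).
Local Notation K := (Cplx R).

Record CK_family (A : cstarAlgType K) (P : vertex E -> A) (S : edge E -> A) :
  Prop := CKFamily {
  CK_proj : forall v, projection (P v);
  CK_proj_orth : forall v w, v != w -> P v ** P w = 0;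
  CK_isom : forall e, partial_isometry (S e);
  CK_range_orth : forall e f, e != f ->
    (S e ** star (S e)) ** (S f ** star (S f)) = 0;
  CK_initial : forall e, star (S e) ** S e = P (rng e);
  CK_final : forall e, cstar_le (S e ** star (S e)) (P (src e));
  CK_sum : forall v, ~ sink v ->
    P v = \sum_(e | src e == v) S e ** star (S e) }.

Definition generated_by (A : cstarAlgType K) (X : set A) : Prop :=
  forall D : set A,
    closed D -> X `<=` D -> D 0 ->
    (forall (c : K) x y, D x -> D y -> D (c *: x + y)) ->
    (forall x y, D x -> D y -> D (x ** y)) ->
    (forall x, D x -> D (star x)) ->
    D = setT.

(* (A, P, S) is a model of C*(E): it is generated by a Cuntz-Krieger E-family and
   is universal for such families; this determines it up to isomorphism. *)
Record is_graph_algebra (A : cstarAlgType K) (P : vertex E -> A)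
  (S : edge E -> A) : Prop := IsGraphAlgebra {
  graph_algebra_CK : CK_family P S;
  graph_algebra_generated : generated_by (range P `|` range S);
  graph_algebra_universal : forall (B : cstarAlgType K) (Q : vertex E -> B)
    (T : edge E -> B), CK_family Q T ->
    exists phi : A -> B,
      [/\ star_hom phi, forall v, phi (P v) = Q v & forall e, phi (S e) = T e] }.

(* There is exactly one such gamma, by the universal property. *)
Record gauge_action (A : cstarAlgType K) (P : vertex E -> A) (S : edge E -> A)
  (gamma : circle K -> A -> A) : Prop := GaugeAction {
  gauge_action_action : cstar_action gamma;
  gauge_vertex : forall z v, gamma z (P v) = P v;
  gauge_edge : forall (z : circle K) e, gamma z (S e) = (z : K) *: S e }.

Definition restrict_unity (A : cstarAlgType K) (gamma : circle K -> A -> A)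
  (k : nat) : unity K k -> A -> A := fun z => gamma z.

End GraphAlgebra.

(* Main.v *)
(* C^*(E) is a direct sum of matrix algebras over the sinks v, with matrix units
   S_mu S_nu^* for paths mu, nu ending at v, and z in Z/k acts by conjugation
   with U_z = diag(z^|mu|).

   A finite LT or SLT dimension writes 1 as a sum of squares b b, where b is
   orthogonal to its translates under z <> 1. As tr (U_z b b) = tr (b U_z b) =
   tr (b alpha_z(b) U_z) = 0, the trace of U_z at every sink vanishes for all
   z <> 1, and Fourier inversion on Z/k gives equal path counts. That the matrix
   units are nonzero follows from universality, by mapping C^*(E) to the matrix
   algebra on the paths that end at sinks.

   Conversely, equal counts provide a bijective shift of the paths ending at
   each sink that raises the length by 1 modulo k. The corresponding unitary W
   satisfies W^k = 1 and alpha_z(W) = z W, and its functional calculus is an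
   equivariant unital homomorphism C(Z/k) -> C^*(E). *)
Require Import Defs.
From HB Require Import structures.
From mathcomp Require Import all_boot all_order all_algebra.
From mathcomp Require Import finmap cyclic separable cyclotomic sesquilinear spectral.
From mathcomp Require Import all_classical all_reals all_analysis.
From mathcomp Require Import complex ring.
Import numFieldNormedType.Exports.
Import Order.TTheory GRing.Theory Num.Theory.

Set Implicit Arguments.
Unset Strict Implicit.
Unset Printing Implicit Defensive.

Local Open Scope classical_set_scope.
Local Open Scope ring_scope.

(** * Completeness of the complex numbers *)

(** The universal property of C^*(E) speaks of C*-algebras only, so the nonvanishing of the sink
    projections needs a genuine C*-algebra to map to: matrices with the operator norm, including the
    completeness of that norm. The direct sum decomposition itself is never built. Its substitute is
    the statement that each compression [star (s i) ** a ** s j] is a scalar multiple of a sink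
    projection. This holds for the generators and passes to linear combinations, products, adjoints
    and limits, hence holds on all of C^*(E); the limits require that the line spanned by a
    projection be closed. The scalars multiply like matrix entries, which is enough for traces.

    The squares arise from indicator functions of points of Z/k: each is orthogonal to its
    nontrivial translates, and this survives multiplication by a weight that the group leaves
    invariant. The weights sqrt t on the cone and sqrt (1 - s), sqrt s on the join make the squares
    add up to the unit. One trace argument then serves both dimensions, and the implication from (a)
    to (b) passes through (c). *)

Section ComplexLimits.
Variable R : realType.
Local Notation K := (Cplx R).

Lemma toCplx_norm (x : R) : `|toCplx x| = toCplx `|x|.
Proof.
by rewrite [LHS]normc_def /= expr0n addr0 sqrtr_sqr.
Qed.

Lemma ler_toCplx (x y : R) : (toCplx x <= toCplx y) = (x <= y).
Proof. exact: lecR. Qed.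

Lemma ltr_toCplx (x y : R) : (toCplx x < toCplx y) = (x < y).
Proof. exact: ltcR. Qed.

Lemma toCplx_Re (x : K) : x \is Num.real -> toCplx (complex.Re x) = x.
Proof. exact: RRe_real. Qed.

Lemma cplxE (z : K) : z = toCplx (complex.Re z) + 'i * toCplx (complex.Im z).
Proof. by rewrite [LHS]complexE complexiE. Qed.

Lemma cplx_dist_le (a b : R) (z : K) :
  `|toCplx a + 'i * toCplx b - z| <=
    toCplx (`|a - complex.Re z| + `|b - complex.Im z|).
Proof.
have -> : toCplx a + 'i * toCplx b - z =
    toCplx (a - complex.Re z) + 'i * toCplx (b - complex.Im z).
  rewrite {1}(cplxE z) ![toCplx (_ - _)](rmorphB (real_complex R)).
  by rewrite mulrBr opprD addrACA.
rewrite [toCplx (`|_| + _)](rmorphD (real_complex R)).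
apply: le_trans (ler_normD _ _) _.
rewrite normrM normCi mul1r !toCplx_norm; exact: lexx.
Qed.

Lemma Re_norm_le (z : K) : toCplx `|complex.Re z| <= `|z|.
Proof. exact: normc_ge_Re. Qed.

Lemma Im_norm_le (z : K) : toCplx `|complex.Im z| <= `|z|.
Proof.
rewrite [X in _ <= X]normc_def ler_toCplx -sqrtr_sqr ler_wsqrtr//.
by rewrite lerDr sqr_ge0.
Qed.

(** A map with Lipschitz constant 1 carries Cauchy filters to Cauchy filters, so the completeness of
    [R] applies. The maps in view are the real and imaginary parts of scalars and of matrix
    entries. *)
Lemma cvg_dist_le (V : normedModType K) (f : V -> R) (F : set_system V) :
    ProperFilter F -> cauchy F ->
    (forall x y, toCplx `|f x - f y| <= `|x - y|) ->
  cvg (f @ F).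
Proof.
move=> PF cF hf; apply: R_complete; apply: cauchy_exP => e e0.
have /cauchyP /(_ (toCplx e)) := cF.
case; first by rewrite -[0]/(toCplx 0) ltr_toCplx.
move=> x Fx; exists (f x); rewrite /= nbhs_simpl /=.
apply: filterS Fx => y; rewrite -!ball_normE /= => xy.
by rewrite -ltr_toCplx; exact: le_lt_trans xy.
Qed.

Lemma Cplx_complete (F : set_system K) :
  ProperFilter F -> cauchy F -> cvg F.
Proof.
move=> PF cF.
have /cvg_ex[a Fa] : cvg (@complex.Re R @ F).
  apply: (@cvg_dist_le K) => // x y.
  by rewrite -raddfB; exact: Re_norm_le.
have /cvg_ex[b Fb] : cvg (@complex.Im R @ F).
  apply: (@cvg_dist_le K) => // x y.
  by rewrite -raddfB; exact: Im_norm_le.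
apply/cvg_ex; exists (toCplx a + 'i * toCplx b).
have -> : nbhs F = nbhs ((fun z : K => toCplx (complex.Re z) +
   'i * toCplx (complex.Im z)) @ F).
  rewrite !nbhs_simpl; apply/seteqP; split => U /=;
   apply: filterS => z /=; by rewrite -cplxE.
apply: cvgD.
  by apply: (cvg_comp _ _ Fa); exact: toCplx_continuous.
apply: cvgZr; apply: (cvg_comp _ _ Fb); exact: toCplx_continuous.
Qed.

End ComplexLimits.

(** * The C*-algebra of matrices *)

Lemma trmxC_mul (C : numClosedFieldType) m n p (A : 'M[C]_(m, n)) (B : 'M[C]_(n, p)) :
  ((A *m B) ^t* = B ^t* *m A ^t* )%sesqui.
Proof. by rewrite trmx_mul map_mxM. Qed.

(* [N A] is the least upper bound of |<u A, v>| over the unit balls. This section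
   uses only that property; existence of the bound needs completeness of [C]. *)
Section OperatorNorm.
Variables (C : numClosedFieldType) (n : nat).
Implicit Types (A B : 'M[C]_n) (u v : 'rV[C]_n).
Local Notation "''[' u , v ]" := (dotmx u v) : ring_scope.
Local Notation "''[' u ]" := (dotmx u u) : ring_scope.
Local Notation adj A := (A ^t* )%sesqui.

Lemma dotmx_adj A u v : '[u *m A, v] = '[u, v *m adj A].
Proof. by rewrite !dotmxE trmxC_mul mulmxA trmxCK. Qed.

Lemma dotmx_CS u v : `|'[u, v]| <= sqrtC '[u] * sqrtC '[v].
Proof. by have [] := CauchySchwarz_sqrt (@dotmx C n) u v. Qed.

Lemma dotmx_conj u v : '[u, v] = ('[v, u])^*.
Proof. by rewrite (hermC (@dotmx C n)) /= expr0 mul1r. Qed.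

(** Entries of a vector in the unit ball have modulus at most 1. The bound makes the supremum behind
    the operator norm finite, and lets entrywise convergence control the norm. *)
Lemma dotmx_le_entries A u v : '[u] <= 1 -> '[v] <= 1 ->
  `|'[u *m A, v]| <= \sum_i \sum_j `|A i j|.
Proof.
have entry (w : 'rV[C]_n) i : '[w] <= 1 -> `|w 0 i| <= 1.
  move=> w1; rewrite -(@expr_le1 _ 2)// normCK; apply: le_trans w1.
  rewrite dotmxE mxE (bigD1 i)//= !mxE lerDl; apply: sumr_ge0 => j _.
  by rewrite !mxE mul_conjC_ge0.
move=> u1 v1; rewrite dotmxE mxE; apply: le_trans (ler_norm_sum _ _ _) _.
rewrite exchange_big /=; apply: ler_sum => j _.
rewrite !mxE mulr_suml; apply: le_trans (ler_norm_sum _ _ _) _.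
apply: ler_sum => i _; rewrite !normrM norm_conjC.
apply: le_trans (_ : 1 * `|A i j| * 1 <= _); last by rewrite mulr1 mul1r.
by rewrite ler_pM ?mulr_ge0// ?ler_pM ?entry.
Qed.

Lemma entry_dotmx A i j : A i j = '[delta_mx 0 i *m A, delta_mx 0 j].
Proof.
rewrite dotmxE -rowE mxE (bigD1 j)//= big1 => [|k kj]; rewrite !mxE ?eqxx/=.
  by rewrite addr0 conjC1 mulr1.
by rewrite (negPf kj) conjC0 mulr0.
Qed.

Let dnorm_nneg u : 0 <= '[u].
Proof. exact: (dnorm_ge0 (@dotmx C n)). Qed.

Let sqrt_dnorm_gt0 u : u != 0 -> 0 < sqrtC '[u].
Proof. by rewrite sqrtC_gt0 -(dnorm_gt0 (@dotmx C n)). Qed.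

Let dnormZE (c : C) u : '[c *: u] = `|c| ^+ 2 * '[u].
Proof. exact: (dnormZ (@dotmx C n)). Qed.

Let dotmxZl c u v : '[c *: u, v] = c * '[u, v].
Proof. exact: linearZl_LR. Qed.

Let dotmxZr c u v : '[u, c *: v] = c^* * '[u, v].
Proof. exact: linearZr_LR. Qed.

Let dotmxDl u1 u2 v : '[u1 + u2, v] = '[u1, v] + '[u2, v].
Proof. exact: linearDl. Qed.

Let dotmx0l v : '[0, v] = 0. Proof. exact: linear0l. Qed.
Let dotmx0r v : '[v, 0] = 0. Proof. exact: linear0r. Qed.

Let sqrtC_le1 u : '[u] <= 1 -> sqrtC '[u] <= 1.
Proof. by move=> u1; rewrite -sqrtC1 ler_sqrtC// nnegrE. Qed.

Variable N : 'M[C]_n -> C.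
Hypothesis N_ub : forall A u v, '[u] <= 1 -> '[v] <= 1 -> `|'[u *m A, v]| <= N A.
Hypothesis N_least : forall A c, 0 <= c ->
  (forall u v, '[u] <= 1 -> '[v] <= 1 -> `|'[u *m A, v]| <= c) -> N A <= c.

Lemma form_norm_ge0 A : 0 <= N A.
Proof. by apply: le_trans (N_ub A (u := 0) (v := 0) _ _); rewrite ?dotmx0l. Qed.
Local Notation N_ge0 := form_norm_ge0.

Lemma dotmx_form_norm A u v : `|'[u *m A, v]| <= N A * (sqrtC '[u] * sqrtC '[v]).
Proof.
have [->|u0] := eqVneq u 0.
  by rewrite mul0mx !dotmx0l normr0 !mulr_ge0 ?N_ge0 ?sqrtC_ge0 ?dotmx0l.
have [->|v0] := eqVneq v 0.
  by rewrite !dotmx0r normr0 !mulr_ge0 ?N_ge0 ?sqrtC_ge0 ?dotmx0l.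
have unit (w : 'rV[C]_n) : w != 0 -> '[(sqrtC '[w])^-1 *: w] <= 1.
  move=> w0; rewrite dnormZE normfV ger0_norm; last exact/ltW/sqrt_dnorm_gt0.
  by rewrite exprVn sqrtCK mulVf// -sqrtC_eq0 gt_eqF ?sqrt_dnorm_gt0.
have := N_ub A (unit u u0) (unit v v0).
rewrite -scalemxAl dotmxZl dotmxZr !normrM norm_conjC !normfV.
have := sqrt_dnorm_gt0 u0; have := sqrt_dnorm_gt0 v0.
move: (sqrtC '[u]) (sqrtC '[v]) => x y y0 x0.
rewrite (gtr0_norm x0) (gtr0_norm y0) mulrA -invfM mulrC.
by rewrite ler_pdivrMr ?mulr_gt0.
Qed.

(** Test the form against [v = u *m A] and cancel one factor of the norm of [u *m A]. *)
Lemma form_norm_row A u : sqrtC '[u *m A] <= N A * sqrtC '[u].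
Proof.
have [->|uA0] := eqVneq (u *m A) 0.
  by rewrite !dotmx0l sqrtC0 mulr_ge0 ?N_ge0 ?sqrtC_ge0.
have p := sqrt_dnorm_gt0 uA0.
rewrite -(ler_pM2r p) -mulrA; apply: le_trans (dotmx_form_norm _ _ _).
by rewrite -expr2 sqrtCK ger0_norm.
Qed.

Lemma form_normD A B : N (A + B) <= N A + N B.
Proof.
apply: N_least => [|u v u1 v1]; first by rewrite addr_ge0 ?N_ge0.
rewrite mulmxDr dotmxDl; apply: le_trans (ler_normD _ _) _.
by rewrite lerD ?N_ub.
Qed.

Lemma form_normZ (c : C) A : N (c *: A) = `|c| * N A.
Proof.
have le_Z (a : C) B : N (a *: B) <= `|a| * N B.
  apply: N_least => [|u v u1 v1]; first by rewrite mulr_ge0 ?N_ge0.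
  by rewrite -scalemxAr dotmxZl normrM ler_wpM2l ?N_ub.
apply/eqP; rewrite eq_le le_Z/=; have [->|c0] := eqVneq c 0.
  by rewrite normr0 mul0r N_ge0.
rewrite -{1}[A](scalerK c0) -ler_pdivlMl ?normr_gt0// -normfV.
exact: le_Z.
Qed.

Lemma entry_form_norm A i j : `|A i j| <= N A.
Proof.
have unit k : '[delta_mx 0 k : 'rV[C]_n] <= 1.
  by rewrite -{1}[delta_mx 0 k]mulmx1 -entry_dotmx mxE eqxx.
by rewrite entry_dotmx; exact: N_ub.
Qed.

Lemma form_norm_le_entries A : N A <= \sum_i \sum_j `|A i j|.
Proof.
apply: N_least => [|u v]; last exact: dotmx_le_entries.
by apply: sumr_ge0 => i _; apply: sumr_ge0.
Qed.

Lemma form_norm_eq0 A : N A = 0 -> A = 0.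
Proof.
move=> A0; apply/matrixP => i j; rewrite mxE; apply/eqP.
by rewrite -normr_le0 -A0 entry_form_norm.
Qed.

Lemma form_norm_adj A : N (adj A) = N A.
Proof.
have le_adj B : N (adj B) <= N B.
  apply: N_least => [|u v u1 v1]; first exact: N_ge0.
  by rewrite dotmx_adj trmxCK dotmx_conj norm_conjC N_ub.
by apply/eqP; rewrite eq_le le_adj -{1}[A]trmxCK le_adj.
Qed.

(** Moving [B] to the other side leaves the pairing of [u *m A] with [v *m adj B]; Cauchy-Schwarz
    separates the factors, and the adjoint has the same norm. *)
Lemma form_normM A B : N (A *m B) <= N A * N B.
Proof.
apply: N_least => [|u v u1 v1]; first by rewrite mulr_ge0 ?N_ge0.
rewrite mulmxA dotmx_adj -(form_norm_adj B).
apply: le_trans (dotmx_CS _ _) _.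
have bound D (w : 'rV_n) : '[w] <= 1 -> sqrtC '[w *m D] <= N D.
  move=> w1; apply: le_trans (form_norm_row _ _) _.
  by rewrite ler_piMr ?N_ge0 ?sqrtC_le1.
by rewrite ler_pM ?sqrtC_ge0 ?bound.
Qed.

(** On the unit balls Cauchy-Schwarz bounds the form of [A] by the length of [v *m adj A], whose
    square is the form of [adj A *m A] at [v, v]. The other inequality is submultiplicativity. *)
Lemma form_norm_cstar A : N (adj A *m A) = N A ^+ 2.
Proof.
apply/eqP; rewrite eq_le; apply/andP; split.
  by apply: le_trans (form_normM _ _) _; rewrite form_norm_adj expr2.
rewrite -[N (_ *m _)]sqrtCK ler_sqr ?nnegrE ?sqrtC_ge0 ?N_ge0//.
apply: N_least => [|u v u1 v1]; first by rewrite sqrtC_ge0 N_ge0.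
rewrite dotmx_adj; apply: le_trans (dotmx_CS _ _) _.
apply: le_trans (_ : 1 * sqrtC (N (adj A *m A)) <= _); last by rewrite mul1r.
rewrite ler_pM ?sqrtC_ge0 ?sqrtC_le1// ler_sqrtC ?nnegrE ?N_ge0//.
rewrite -dotmx_adj -mulmxA -[leLHS]ger0_norm ?N_ub//.
by rewrite mulmxA dotmx_adj.
Qed.

End OperatorNorm.

Section ComplexOperatorNorm.
Variables (R : realType) (n : nat).
Local Notation K := (Cplx R).
Implicit Types (A : 'M[K]_n) (u v : 'rV[K]_n).

(** Suprema are available in [R], whereas moduli are elements of [K]; hence the set of real
    preimages. *)
Definition form_values A : set R :=
  [set r | exists u v, [/\ dotmx u u <= 1, dotmx v v <= 1
    & toCplx r = `|dotmx (u *m A) v|]].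

Definition opnorm A : K := toCplx (sup (form_values A)).

Lemma form_values_has_sup A : has_sup (form_values A).
Proof.
split.
  exists (complex.Re `|dotmx ((0 : 'rV[K]_n) *m A) 0|); exists 0, 0.
  by rewrite linear0l toCplx_Re ?normr_real.
exists (complex.Re (\sum_i \sum_j `|A i j|)) => r [u [v [u1 v1 ruv]]].
rewrite -ler_toCplx ruv toCplx_Re; first exact: dotmx_le_entries.
by rewrite ger0_real// sumr_ge0// => i _; rewrite sumr_ge0.
Qed.

Lemma opnorm_ub A u v : dotmx u u <= 1 -> dotmx v v <= 1 ->
  `|dotmx (u *m A) v| <= opnorm A.
Proof.
move=> u1 v1; rewrite -[leLHS]toCplx_Re ?normr_real// ler_toCplx.
apply: (sup_upper_bound (form_values_has_sup A)).
by exists u, v; split; rewrite // toCplx_Re ?normr_real.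
Qed.

Lemma opnorm_least A (c : K) : 0 <= c ->
  (forall u v, dotmx u u <= 1 -> dotmx v v <= 1 -> `|dotmx (u *m A) v| <= c) ->
  opnorm A <= c.
Proof.
move=> c0 cA; rewrite -[leRHS]toCplx_Re ?ger0_real// ler_toCplx.
apply: ge_sup; first by have [] := form_values_has_sup A.
move=> r [u [v [u1 v1 ruv]]].
by rewrite -ler_toCplx ruv toCplx_Re ?ger0_real// cA.
Qed.

End ComplexOperatorNorm.

Section MatrixAlgebra.
Variables (R : realType) (n : nat).
Local Notation K := (Cplx R).

(* A copy of 'M_n that carries the operator norm instead of the max norm. *)
Definition opmx := 'M[K]_n.

HB.instance Definition _ := GRing.Lmodule.copy opmx 'M[K]_n.

HB.instance Definition _ := @Lmodule_isNormed.Build K opmx (@opnorm R n)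
  (form_normD (@opnorm_ub R n) (@opnorm_least R n))
  (form_normZ (@opnorm_ub R n) (@opnorm_least R n))
  (form_norm_eq0 (@opnorm_ub R n)).

(** The norm dominates every entry, so the entries converge; the sum of the moduli of the entries
    dominates the norm, so entrywise convergence is convergence in norm. *)
Let opmx_complete (F : set_system opmx) : ProperFilter F -> cauchy F -> cvg F.
Proof.
move=> PF cF.
have entry (X : opmx) i j : `|(X : 'M[K]_n) i j| <= `|X|.
  exact: (entry_form_norm (@opnorm_ub R n) X).
have ReP i j : cvg ((fun X : opmx => complex.Re ((X : 'M[K]_n) i j)) @ F).
  apply: cvg_dist_le => // X Y; rewrite -raddfB.
  apply: le_trans (Re_norm_le _) _; apply: le_trans (entry (X - Y) i j).
  by rewrite /= !mxE.
have ImP i j : cvg ((fun X : opmx => complex.Im ((X : 'M[K]_n) i j)) @ F).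
  apply: cvg_dist_le => // X Y; rewrite -raddfB.
  apply: le_trans (Im_norm_le _) _; apply: le_trans (entry (X - Y) i j).
  by rewrite /= !mxE.
pose a i j := lim ((fun X : opmx => complex.Re ((X : 'M[K]_n) i j)) @ F).
pose b i j := lim ((fun X : opmx => complex.Im ((X : 'M[K]_n) i j)) @ F).
pose L : opmx := \matrix_(i, j) (toCplx (a i j) + 'i * toCplx (b i j)).
apply/cvg_ex; exists L; apply/cvgrPdist_lt => e e0.
(* There are n^2 entries, each with an error of at most 2d from its real and imaginary parts. The
   extra 1 makes the final inequality strict, also for [n = 0]. *)
pose N : R := (n * n * 2).+1%:R.
pose d : R := complex.Re e / N.
have eE : e = toCplx (complex.Re e) by rewrite toCplx_Re ?gtr0_real.
have re0 : 0 < complex.Re e by rewrite -ltr_toCplx -eE.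
have d0 : 0 < d by rewrite divr_gt0 ?ltr0n.
have near1 i j : \forall X \near F,
    `|a i j - complex.Re ((X : 'M[K]_n) i j)| < d.
  by have /cvgrPdist_lt/(_ d d0) := ReP i j.
have near2 i j : \forall X \near F,
    `|b i j - complex.Im ((X : 'M[K]_n) i j)| < d.
  by have /cvgrPdist_lt/(_ d d0) := ImP i j.
have allnear (Q : 'I_n -> 'I_n -> opmx -> Prop) :
    (forall i j, \forall X \near F, Q i j X) ->
    \forall X \near F, forall i j, Q i j X.
  move=> FQ.
  by apply: filter_forall => i; apply: filter_forall => j; exact: FQ.
near=> X.
have X1 : forall i j, `|a i j - complex.Re ((X : 'M[K]_n) i j)| < d.
  by near: X; exact: allnear near1.
have X2 : forall i j, `|b i j - complex.Im ((X : 'M[K]_n) i j)| < d.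
  by near: X; exact: allnear near2.
apply: le_lt_trans (form_norm_le_entries (@opnorm_least R n) (L - X)) _.
apply: (@le_lt_trans _ _ (\sum_(i < n) \sum_(j < n) toCplx (d + d))).
  apply: ler_sum => i _; apply: ler_sum => j _.
  have -> : (L - X : 'M[K]_n) i j =
      (toCplx (a i j) + 'i * toCplx (b i j)) - (X : 'M[K]_n) i j by rewrite !mxE.
  apply: le_trans (cplx_dist_le _ _ _) _.
  by rewrite ler_toCplx lerD// ltW.
rewrite !sumr_const !card_ord -mulrnA eE -raddfMn ltr_toCplx /d -mulr2n -mulrnA.
rewrite -[ltLHS]mulr_natr mulrAC ltr_pdivrMr ?ltr0n// ltr_pM2l// ltr_nat.
by rewrite mulnC ltnS.
Unshelve. all: by end_near.
Qed.

HB.instance Definition _ := @Uniform_isComplete.Build opmx opmx_complete.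

Program Definition opmx_starMixin := @isStarAlgebra.Build K opmx
  (fun A B => A *m B : 'M[K]_n) (fun A => A ^t* : 'M[K]_n)%sesqui _ _ _ _ _ _ _ _ _.
Next Obligation. by move=> A B C; rewrite mulmxA. Qed.
Next Obligation. by move=> A B C; rewrite mulmxDl. Qed.
Next Obligation. by move=> A B C; rewrite mulmxDr. Qed.
Next Obligation. by move=> c A B; exact/esym/(@scalemxAl K n n n c A B). Qed.
Next Obligation. by move=> c A B; exact/esym/(@scalemxAr K n n n c A B). Qed.
Next Obligation. by move=> A; rewrite trmxCK. Qed.
Next Obligation. by move=> A B; rewrite -map_mxD -linearD. Qed.
Next Obligation. by move=> c A; rewrite -map_mxZ -linearZ. Qed.
Next Obligation. exact: trmxC_mul. Qed.
HB.instance Definition _ := opmx_starMixin.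

HB.instance Definition _ := @isCStarAlgebra.Build K opmx
  (form_normM (@opnorm_ub R n) (@opnorm_least R n))
  (form_norm_cstar (@opnorm_ub R n) (@opnorm_least R n)).

End MatrixAlgebra.

(** * *-algebras and C*-algebras *)

Section StarAlgebraTheory.
Variables (K : numClosedFieldType) (A : starAlgType K).
Implicit Types x y : A.

Lemma amul0l x : 0 ** x = 0.
Proof. by rewrite -[X in X ** _](scale0r 0) amulZl scale0r. Qed.

Lemma amul0r x : x ** 0 = 0.
Proof. by rewrite -[X in _ ** X](scale0r 0) amulZr scale0r. Qed.

Lemma amulBl x y z : (x - y) ** z = x ** z - y ** z.
Proof. by rewrite -[- y]scaleN1r amulDl amulZl scaleN1r. Qed.

Lemma amulBr x y z : z ** (x - y) = z ** x - z ** y.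
Proof. by rewrite -[- y]scaleN1r amulDr amulZr scaleN1r. Qed.

Lemma amul_suml I (r : seq I) (Q : pred I) (F : I -> A) x :
  (\sum_(i <- r | Q i) F i) ** x = \sum_(i <- r | Q i) F i ** x.
Proof. by rewrite (big_morph (fun y => y ** x) (fun y z => amulDl y z x) (amul0l x)). Qed.

Lemma amul_sumr I (r : seq I) (Q : pred I) (F : I -> A) x :
  x ** (\sum_(i <- r | Q i) F i) = \sum_(i <- r | Q i) x ** F i.
Proof. by rewrite (big_morph (amul x) (amulDr x) (amul0r x)). Qed.

Lemma star0 : star (0 : A) = 0.
Proof. by rewrite -[X in star X](scale0r 0) starZ conjC0 scale0r. Qed.

Lemma star_sum I (r : seq I) (Q : pred I) (F : I -> A) :
  star (\sum_(i <- r | Q i) F i) = \sum_(i <- r | Q i) star (F i).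
Proof. exact: (big_morph _ (@starD K A) star0). Qed.

End StarAlgebraTheory.

Section StarHomTheory.
Variables (K : numClosedFieldType) (A B : starAlgType K) (f : A -> B).
Hypothesis hf : star_hom f.

Lemma star_homD : {morph f : x y / x + y}.
Proof. by move=> x y; rewrite -[x]scale1r (star_hom_linear hf) !scale1r. Qed.

Lemma star_hom0 : f 0 = 0.
Proof. by apply: (addrI (f 0)); rewrite -star_homD !addr0. Qed.

Lemma star_homZ c : {morph f : x / c *: x}.
Proof. by move=> x; rewrite -[c *: x]addr0 (star_hom_linear hf) star_hom0 addr0. Qed.

Lemma star_hom_sum I (r : seq I) (Q : pred I) (F : I -> A) :
  f (\sum_(i <- r | Q i) F i) = \sum_(i <- r | Q i) f (F i).
Proof. exact: (big_morph _ star_homD star_hom0). Qed.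

End StarHomTheory.

Lemma star_hom_comp (K : numClosedFieldType) (A B C : starAlgType K)
    (f : A -> B) (g : B -> C) :
  star_hom f -> star_hom g -> star_hom (g \o f).
Proof.
move=> hf hg; split=> [c x y|x y|x] /=.
- by rewrite (star_hom_linear hf) (star_hom_linear hg).
- by rewrite (star_homM hf) (star_homM hg).
- by rewrite (star_hom_star hf) (star_hom_star hg).
Qed.

Section CStarTopology.
Variables (K : numClosedFieldType) (A : cstarAlgType K).
Implicit Types x y : A.

Lemma amulr_continuous x : continuous (fun a : A => x ** a).
Proof.
move=> a; apply/cvgrPdist_lt => e e0.
have x1 : 0 < `|x| + 1 by rewrite ltr_wpDl.
near=> b; rewrite -amulBr; apply: le_lt_trans (norm_amul _ _) _.
apply: (@le_lt_trans _ _ ((`|x| + 1) * `|a - b|)).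
  by rewrite ler_wpM2r// lerDl.
rewrite mulrC -ltr_pdivlMr//; near: b.
by apply: cvgr_dist_lt; [exact: cvg_id | rewrite divr_gt0].
Unshelve. all: by end_near. Qed.

Lemma amull_continuous y : continuous (fun a : A => a ** y).
Proof.
move=> a; apply/cvgrPdist_lt => e e0.
have y1 : 0 < `|y| + 1 by rewrite ltr_wpDl.
near=> b; rewrite -amulBl; apply: le_lt_trans (norm_amul _ _) _.
apply: (@le_lt_trans _ _ (`|a - b| * (`|y| + 1))).
  by rewrite ler_wpM2l// lerDl.
rewrite -ltr_pdivlMr//; near: b.
by apply: cvgr_dist_lt; [exact: cvg_id | rewrite divr_gt0].
Unshelve. all: by end_near. Qed.

Lemma projection_norm (p : A) : projection p -> p != 0 -> `|p| = 1 :> K.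
Proof.
move=> [ps pp] p0; have := cstar_identity p; rewrite ps pp expr2 -[X in X = _]mulr1.
by move/mulfI => /(_ _)/esym; apply; rewrite normr_eq0.
Qed.

End CStarTopology.

(* [c *: p] is determined by [c] isometrically, so a limit of such multiples
   yields a Cauchy filter of scalars. *)
Lemma projection_line_closed (K : numClosedFieldType) (A : cstarAlgType K) (p : A) :
  (forall F : set_system K, ProperFilter F -> cauchy F -> cvg F) ->
  projection p -> closed [set a | exists c, a = c *: p].
Proof.
move=> K_complete pp y cy; have [p0|p0] := eqVneq p 0.
  exists 0; rewrite scale0r; apply/eqP; rewrite -normr_le0; apply/ler_addgt0Pl => e e0.
  have [_ [[c ->]]] := cy _ (nbhsx_ballx y e e0).
  by rewrite -ball_normE /= p0 scaler0 subr0 addr0 => /ltW.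
have p1 := projection_norm pp p0.
pose F := filter_from [set e : K | 0 < e] (fun e => [set c | `|y - c *: p| < e]).
have PF : ProperFilter F.
  apply: filter_from_proper => [|e e0]; last first.
    have [_ [[c ->]]] := cy _ (nbhsx_ballx y e e0).
    by rewrite -ball_normE /= => yc; exists c.
  apply: filter_from_filter => [|e1 e2 e10 e20]; first by exists 1 => /=.
  have e12 : e1 >=< e2 by rewrite real_comparable// gtr0_real.
  exists (Order.min e1 e2) => [|c] /=.
    by case: (comparable_ltP e12).
  by rewrite comparable_lt_min// => /andP.
have /K_complete/cvg_ex[c Fc] : cauchy F.
  apply: cauchy_exP => e e0; have e20 : 0 < e / 2 by rewrite divr_gt0.
  have [_ [[c ->]]] := cy _ (nbhsx_ballx y _ e20).
  rewrite -ball_normE /= => yc; exists c; exists (e / 2) => //= c' yc'.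
  rewrite -ball_normE /= -[ltLHS]mulr1 -p1 -normrZ scalerBl.
  have -> : c *: p - c' *: p = (y - c' *: p) - (y - c *: p).
    by rewrite opprB [RHS]addrC addrA subrK.
  rewrite (splitr e); apply: le_lt_trans (ltrD yc' yc).
  exact: ler_normB.
exists c; apply/eqP; rewrite -subr_eq0 -normr_le0; apply/ler_addgt0Pl => e e0.
have e20 : 0 < e / 2 by rewrite divr_gt0.
rewrite addr0; near F => c'.
have yc' : `|y - c' *: p| < e / 2.
  by near: c'; exists (e / 2).
have cc' : `|c - c'| < e / 2.
  by near: c'; apply: cvgr_dist_lt.
rewrite (splitr e) -(subrK (c' *: p) y) -addrA -scalerBl.
apply: le_trans (ler_normD _ _) _; apply: lerD; first exact: ltW.
by rewrite normrZ p1 mulr1 distrC ltW.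
Unshelve. all: by end_near. Qed.

(** * Paths ending at sinks *)

Section SinkPaths.
Variable E : digraph.
Implicit Types (u v : vertex E) (e f : edge E) (s : seq (edge E)).

Definition sinkb v := [forall e : edge E, src e != v].

Lemma sinkP v : reflect (sink v) (sinkb v).
Proof. exact: forallP. Qed.

Lemma is_path_cons u e s :
  is_path (u, e :: s) = (src e == u) && is_path (rng e, s).
Proof. by case: s => [|f s]; rewrite /is_path /= ?(eq_sym (rng e)). Qed.

(** [n] bounds the length. The recursion mirrors the relation [CK_sum]: a vertex that is not a sink
    is split over its outgoing edges. *)
Fixpoint sink_paths (n : nat) u : seq (seq (edge E)) :=
  if sinkb u then [:: [::]] else
  if n is n'.+1 then
    [seq e :: s | e <- enum [pred e | src e == u], s <- sink_paths n' (rng e)]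
  else [::].

Lemma mem_sink_paths n u s : (s \in sink_paths n u) =
  [&& is_path (u, s), sinkb (path_end (u, s)) & (size s <= n)%N].
Proof.
elim: n u s => [|n IHn] u s /=; case: ifPn => su.
- case: s => [|e s]; first by rewrite inE eqxx /path_end /= su.
  by rewrite is_path_cons (negPf (forallP su e)) inE.
- by case: s => [|e s]; rewrite /path_end /= ?(negPf su) ?andbF.
- case: s => [|e s]; first by rewrite inE eqxx /path_end /= su.
  by rewrite is_path_cons (negPf (forallP su e)) inE.
case: s => [|e s].
  rewrite /path_end /= (negPf su); apply/negP.
  by move=> /allpairsPdep[e [t [_ _]]].
rewrite is_path_cons ltnS -andbA.
have -> : path_end (u, e :: s) = path_end (rng e, s) by [].
rewrite -IHn; apply/allpairsPdep/andP => [[f [t [fu tf [-> ->]]]]|[eu es]].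
  by move: fu; rewrite mem_enum.
by exists e, s; rewrite mem_enum.
Qed.

Lemma sink_paths_uniq n u : uniq (sink_paths n u).
Proof.
elim: n u => [|n IHn] u /=; case: ifP => // _.
apply: allpairs_uniq_dep => [|e _|]; [exact: enum_uniq|exact: IHn|].
by move=> [e s] [f t] _ _ [/= <- <-].
Qed.

(** In an acyclic graph no path repeats an edge, so the bound [#|edge E|] loses nothing. Positions
    in this list index the matrices below. *)
Definition all_sink_paths : seq (vertex E * seq (edge E)) :=
  [seq (u, s) | u <- enum (vertex E), s <- sink_paths #|edge E| u].

Lemma all_sink_paths_uniq : uniq all_sink_paths.
Proof.
apply: allpairs_uniq_dep => [|u _|]; [exact: enum_uniq|exact: sink_paths_uniq|].
by move=> [u s] [v t] _ _ [/= <- <-].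
Qed.

Hypothesis acE : acyclic E.

Lemma path_size (p : vertex E * seq (edge E)) : is_path p -> (size p.2 <= #|edge E|)%N.
Proof.
by move=> pp; rewrite -(card_uniqP (acyclic_uniq acE pp)) max_card.
Qed.

Lemma mem_all_sink_paths (p : vertex E * seq (edge E)) :
  (p \in all_sink_paths) = is_path p && sinkb (path_end p).
Proof.
case: p => u s; apply/allpairsPdep/andP => [[v [t [_ + [-> ->]]]]|[pp sp]].
  by rewrite mem_sink_paths => /and3P[].
exists u, s; rewrite mem_enum mem_sink_paths pp sp; split => //.
exact: (path_size pp).
Qed.

End SinkPaths.

(** * Path elements of a Cuntz-Krieger family *)

Section PathElements.
Variables (R : realType) (E : digraph) (A : cstarAlgType (Cplx R)).
Variables (P : vertex E -> A) (S : edge E -> A).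
Hypothesis CK : CK_family P S.
Implicit Types (u v : vertex E) (e f : edge E) (s : seq (edge E)).

Lemma CK_idem v : P v ** P v = P v. Proof. by have [] := CK_proj CK v. Qed.
Lemma CK_self_adj v : star (P v) = P v. Proof. by have [] := CK_proj CK v. Qed.

Lemma CK_SP e : S e ** P (rng e) = S e.
Proof. by rewrite -(CK_initial CK) amulA; exact: (CK_isom CK). Qed.

(** For distinct edges, the range projections of [S e] and [S f] can be inserted between the two
    factors, and they are orthogonal. *)
Lemma CK_SS e f : star (S e) ** S f = if e == f then P (rng e) else 0.
Proof.
have [->|ef] := eqVneq e f; first exact: (CK_initial CK).
rewrite -[S f](CK_isom CK) -[S e](CK_isom CK) !starM starK.
have -> : star (S e) ** (S e ** star (S e)) ** (S f ** star (S f) ** S f) =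
    star (S e) ** ((S e ** star (S e)) ** (S f ** star (S f))) ** S f.
  by rewrite !amulA.
by rewrite (CK_range_orth CK ef) amul0r amul0l.
Qed.

(** [src e] emits [e], so [CK_sum] expands its projection; only the summand of [e] survives against
    [S e]. *)
Lemma CK_PS e : P (src e) ** S e = S e.
Proof.
rewrite (CK_sum CK); last by move=> /(_ e); rewrite eqxx.
rewrite amul_suml (bigD1 e)//= (CK_isom CK) big1 ?addr0// => f /andP[_ fe].
by rewrite -amulA CK_SS (negPf fe) amul0r.
Qed.

Lemma CK_PS_neq v e : src e != v -> P v ** S e = 0.
Proof.
by move=> ev; rewrite -CK_PS amulA (CK_proj_orth CK) ?amul0l// eq_sym.
Qed.

Fixpoint path_elt u s : A :=
  if s is e :: s' then S e ** path_elt (rng e) s' else P u.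

Lemma path_elt_src u v s : is_path (u, s) ->
  P v ** path_elt u s = if u == v then path_elt u s else 0.
Proof.
case: s => [_|e s] /=; have [<-|uv] := eqVneq u v.
- exact: CK_idem.
- by rewrite (CK_proj_orth CK)// eq_sym.
- by rewrite is_path_cons => /andP[/eqP <- _]; rewrite amulA CK_PS.
- rewrite is_path_cons => /andP[/eqP eu _].
  by rewrite amulA CK_PS_neq ?amul0l// eu.
Qed.

Lemma path_elt_end u s : path_elt u s ** P (path_end (u, s)) = path_elt u s.
Proof.
elim: s u => [|e s IHs] u /=; first exact: CK_idem.
by rewrite -amulA IHs.
Qed.

(** Common initial edges cancel. Since both paths end at sinks, neither can be a proper initial
    segment of the other, which is the only way distinct paths could have a nonzero product. *)
Lemma path_elt_orth u s v t :
    is_path (u, s) -> is_path (v, t) ->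
    sink (path_end (u, s)) -> sink (path_end (v, t)) ->
  star (path_elt u s) ** path_elt v t =
    if (u, s) == (v, t) then P (path_end (u, s)) else 0.
Proof.
have path_cons e r w : is_path (w, e :: r) -> w = src e /\ is_path (rng e, r).
  by rewrite is_path_cons => /andP[/eqP].
elim: s u v t => [|e s IHs] u v [|f t] /=.
- move=> _ _ _ _; rewrite CK_self_adj xpair_eqE andbT.
  by have [->|uv] := eqVneq u v; [exact: CK_idem|exact: (CK_proj_orth CK)].
- move=> _ /path_cons[-> _] su _; rewrite CK_self_adj xpair_eqE andbF.
  by rewrite amulA CK_PS_neq ?amul0l//; exact: su.
- move=> /path_cons[-> _] _ _ sv; rewrite xpair_eqE andbF.
  rewrite -[LHS]starK starM starK CK_self_adj amulA CK_PS_neq.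
    by rewrite amul0l star0.
  exact: sv.
- move=> /path_cons[-> ps] /path_cons[-> pt] ss st.
  have -> : star (S e ** path_elt (rng e) s) ** (S f ** path_elt (rng f) t) =
      star (path_elt (rng e) s) ** (star (S e) ** S f) ** path_elt (rng f) t.
    by rewrite starM !amulA.
  rewrite CK_SS; have [ef|ef] := eqVneq e f; last first.
    rewrite amul0r amul0l; case: eqP => // -[_ h _].
    by rewrite h eqxx in ef.
  subst f; rewrite -amulA (path_elt_src (rng e) pt) eqxx IHs//.
  rewrite !xpair_eqE !eqxx/=.
  by rewrite eqseq_cons eqxx.
Qed.

(** Iterate [CK_sum] from [u] until every branch has stopped at a sink; the length bound guarantees
    that this happens within [n] rounds. *)
Lemma path_elt_sum n u :
    (forall s, is_path (u, s) -> (size s <= n)%N) ->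
  P u = \sum_(s <- sink_paths n u) path_elt u s ** star (path_elt u s).
Proof.
elim: n u => [|n IHn] u un /=; case: ifPn => su.
- by rewrite big_seq1 CK_self_adj CK_idem.
- move: su => /forallPn[e]; rewrite negbK => eu.
  by have := un [:: e]; rewrite is_path_cons eu => /(_ isT).
- by rewrite big_seq1 CK_self_adj CK_idem.
rewrite big_allpairs_dep /= big_enum /= (CK_sum CK); last exact/sinkP.
apply: eq_bigr => e eu.
transitivity (S e ** P (rng e) ** star (S e)); first by rewrite CK_SP.
rewrite (IHn (rng e)) => [|s es]; last first.
  by rewrite -ltnS; apply: (un (e :: s)); rewrite is_path_cons eu.
rewrite amul_sumr amul_suml; apply: eq_bigr => s _.
by rewrite starM !amulA.
Qed.

Lemma path_elt_edge e u s :
  is_path (u, s) -> S e ** path_elt u s =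
    if rng e == u then path_elt (src e) (e :: s) else 0.
Proof.
move=> us; rewrite -[S e in LHS]CK_SP -amulA path_elt_src// eq_sym.
by case: eqVneq => [<-//|]; rewrite amul0r.
Qed.

End PathElements.

(** * The representation on paths ending at sinks *)

Section PathMatrices.
Variables (C : numClosedFieldType) (E : digraph).
Hypothesis acE : acyclic E.
Local Notation L := (all_sink_paths E).
Local Notation n := (size L).
Local Notation adj A := (A ^t* )%sesqui.

Definition sink_path (i : 'I_n) : vertex E * seq (edge E) := tnth (in_tuple L) i.

Lemma sink_path_inj : injective sink_path.
Proof. exact/tuple_uniqP/all_sink_paths_uniq. Qed.

Lemma sink_pathP i : is_path (sink_path i) /\ sink (path_end (sink_path i)).
Proof.
have := mem_tnth i (in_tuple L); rewrite (mem_all_sink_paths acE).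
by move=> /andP[pi /sinkP si].
Qed.

Lemma sink_path_onto p : is_path p -> sink (path_end p) ->
  exists i, sink_path i = p.
Proof.
move=> pp sp; have /tnthP[i ->] : p \in in_tuple L.
  by rewrite (mem_all_sink_paths acE) pp; exact/sinkP.
by exists i.
Qed.

Definition dmx (p : pred 'I_n) : 'M[C]_n := \matrix_(i, j) ((i == j) && p i)%:R.

Lemma mul_dmx p (M : 'M[C]_n) : dmx p *m M = \matrix_(i, j) ((p i)%:R * M i j).
Proof.
apply/matrixP => i j; rewrite !mxE (bigD1 i)//= big1 => [|k ki].
  by rewrite !mxE eqxx addr0.
by rewrite !mxE eq_sym (negPf ki) mul0r.
Qed.

Lemma dmxM p q : dmx p *m dmx q = dmx (predI p q).
Proof.
rewrite mul_dmx; apply/matrixP => i j; rewrite !mxE /=.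
by case: (p i) => /=; rewrite ?mul1r ?mul0r ?andbF.
Qed.

Lemma dmx_adj p : adj (dmx p) = dmx p.
Proof.
apply/matrixP => i j; rewrite !mxE eq_sym rmorph_nat.
by have [->|] := eqVneq i j.
Qed.

Lemma dmx0 p : p =1 pred0 -> dmx p = 0.
Proof. by move=> p0; apply/matrixP => i j; rewrite !mxE p0 andbF. Qed.

(** The path [i] is [j] with [e] prepended, so [edge_mx e] is the creation operator of [e] on column
    vectors indexed by paths. The start of [j] is tested separately because an empty [j] has no
    first edge. *)
Definition path_step (e : edge E) (i j : 'I_n) : bool :=
  (sink_path i == (src e, e :: (sink_path j).2)) && ((sink_path j).1 == rng e).

Definition starts_with (e : edge E) (i : 'I_n) : bool :=
  ohead (sink_path i).2 == Some e.

Definition edge_mx (e : edge E) : 'M[C]_n := \matrix_(i, j) (path_step e i j)%:R.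

Definition vertex_mx (v : vertex E) : 'M[C]_n :=
  dmx (fun i => (sink_path i).1 == v).

Lemma starts_withP e i : starts_with e i ->
  (sink_path i).1 = src e /\ exists j, sink_path j = (rng e, behead (sink_path i).2).
Proof.
have [] := sink_pathP i; rewrite /starts_with.
case: (sink_path i) => u [|f s] //=; rewrite is_path_cons => /andP[/eqP fu fs] ss.
by move=> /eqP[<-]; split=> //; apply: sink_path_onto.
Qed.

(** Row [i] of [edge_mx e] has a nonzero entry only if [i] starts with [e], and then just one, in
    the column of the remaining path. *)
Lemma edge_mx_range e : edge_mx e *m adj (edge_mx e) = dmx (starts_with e).
Proof.
apply/matrixP => i k; rewrite !mxE; have [ei|ei] := boolP (starts_with e i).
  have [ie [j je]] := starts_withP ei.
  have ji : path_step e i j.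
    rewrite /path_step je eqxx andbT /=; move: ei ie; rewrite /starts_with.
    by case: (sink_path i) => u [|f s] //= /eqP[->] ->.
  rewrite (bigD1 j)//= big1 => [|j' j'j].
    rewrite !mxE ji mul1r addr0 rmorph_nat andbT; congr (nat_of_bool _)%:R.
    rewrite /path_step je eqxx andbT /=; move/andP: ji => [/eqP + _].
    by rewrite je /= => <-; rewrite (inj_eq sink_path_inj) eq_sym.
  rewrite !mxE; have [/andP[/eqP ij' /eqP j'e]|] := boolP (path_step e i j').
    case/eqP: j'j; apply: sink_path_inj; rewrite je ij' /= -j'e.
    by case: (sink_path j').
  by rewrite mul0r.
rewrite andbF big1// => j _; rewrite !mxE.
have [/andP[/eqP ij _]|] := boolP (path_step e i j); last by rewrite mul0r.
by move: ei; rewrite /starts_with ij /= eqxx.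
Qed.

Lemma edge_mx_initial e : adj (edge_mx e) *m edge_mx e = vertex_mx (rng e).
Proof.
apply/matrixP => i k; rewrite !mxE; have [ie|ie] := eqVneq (sink_path i).1 (rng e).
  have [j je] : exists j, sink_path j = (src e, e :: (sink_path i).2).
    have [] := sink_pathP i; move: ie; case: (sink_path i) => u s /= -> us ss.
    by apply: sink_path_onto; rewrite ?is_path_cons ?eqxx.
  have ji : path_step e j i by rewrite /path_step je ie !eqxx.
  rewrite (bigD1 j)//= big1 => [|j' j'j].
    rewrite !mxE ji rmorph1 mul1r addr0 andbT; congr (nat_of_bool _)%:R.
    rewrite /path_step je xpair_eqE eqseq_cons !eqxx /= -ie andbC.
    rewrite -(inj_eq sink_path_inj).
    case: (sink_path i) => u s; case: (sink_path k) => v t /=.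
    by rewrite xpair_eqE (eq_sym v).
  rewrite !mxE; have [/andP[/eqP ij' _]|] := boolP (path_step e j' i).
    by case/eqP: j'j; apply: sink_path_inj; rewrite je ij'.
  by rewrite rmorph0 mul0r.
rewrite andbF big1// => j _; rewrite !mxE.
by rewrite /path_step (negPf ie) andbF rmorph0 mul0r.
Qed.

Lemma edge_mx_isom e : edge_mx e *m adj (edge_mx e) *m edge_mx e = edge_mx e.
Proof.
rewrite edge_mx_range mul_dmx; apply/matrixP => i j; rewrite !mxE.
case: (boolP (path_step e i j)) => [/andP[/eqP ij _]|]; last by rewrite mulr0.
by rewrite mulr1 /starts_with ij /= eqxx.
Qed.

(** A listed path from [v] ends at a sink, so it is nonempty when [v] is not a sink, and it has
    exactly one first edge. *)
Lemma vertex_mx_sum v : ~ sink v ->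
  vertex_mx v = \sum_(e | src e == v) edge_mx e *m adj (edge_mx e).
Proof.
move=> nv; under eq_bigr do rewrite edge_mx_range.
apply/matrixP => i j; rewrite summxE !mxE; have [<-{j}|ij] := eqVneq i j; last first.
  by rewrite big1// => e _; rewrite mxE (negPf ij).
under eq_bigr do rewrite mxE eqxx /= /starts_with.
have [] := sink_pathP i; case: (sink_path i) => u [|f s] /= ps ss.
  rewrite big1//; case: eqVneq => // uv.
  by case: nv; rewrite -uv.
move: ps; rewrite is_path_cons => /andP[/eqP <- _].
have [fv|fv] := eqVneq (src f) v.
  rewrite (bigD1 f)/= ?fv// eqxx big1 ?addr0// => e /andP[_ ef].
  by case: eqP => // -[fe]; rewrite fe eqxx in ef.
rewrite big1// => e ev; case: eqP => // -[fe].
by rewrite fe ev in fv.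
Qed.

End PathMatrices.

Section SinkProjections.
Variables (R : realType) (E : digraph).
Hypothesis acE : acyclic E.

Lemma path_matrices_CK :
  CK_family (A := opmx R (size (all_sink_paths E)))
    (@vertex_mx (Cplx R) E) (@edge_mx (Cplx R) E).
Proof.
split.
- move=> v; split; first exact: dmx_adj.
  by rewrite /amul/= dmxM; apply/matrixP => i j; rewrite !mxE /= andbb.
- move=> v w vw; rewrite /amul/= dmxM; apply: dmx0 => i /=.
  by have [->|//] := eqVneq; rewrite (negPf vw).
- by move=> e; exact: edge_mx_isom.
- move=> e f ef; rewrite /amul/star/= !edge_mx_range// dmxM; apply: dmx0 => i /=.
  rewrite /starts_with; have [->|//] := eqVneq (ohead _) _.
  by case: eqP => // -[]/eqP; rewrite (negPf ef).
- by move=> e; exact: edge_mx_initial.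
(* The difference is itself a projection: onto the paths from [src e] whose first edge is not
   [e]. *)
- move=> e; exists (dmx (Cplx R)
    (fun i => ((sink_path i).1 == src e) && ~~ starts_with e i)).
  rewrite /amul/star/= edge_mx_range// dmx_adj dmxM.
  apply/matrixP => i j; rewrite !mxE /= andbb.
  case: (eqVneq i j) => //= _; last by rewrite subrr.
  case: (boolP (starts_with e i)) => [/(starts_withP acE)[-> _]|].
    by rewrite eqxx subrr.
  by rewrite subr0 andbT.
- by move=> v; exact: vertex_mx_sum.
Qed.

(** The universal map to path matrices sends [P v] to a matrix with entry 1 at the path of length
    0. *)
Lemma sink_proj_neq0 (A : cstarAlgType (Cplx R)) (P : vertex E -> A)
    (S : edge E -> A) (v : vertex E) :
  is_graph_algebra P S -> sink v -> P v != 0.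
Proof.
move=> gA sv; apply/eqP => Pv0.
have [phi [hphi phiP _]] := graph_algebra_universal gA path_matrices_CK.
have [i iv] : exists i, @sink_path E i = (v, [::]) by exact: sink_path_onto.
have := phiP v; rewrite Pv0 (star_hom0 hphi) => /matrixP/(_ i i)/eqP.
by rewrite !mxE eqxx iv eqxx eq_sym oner_eq0.
Qed.

End SinkProjections.

(** * Matrix units and twisted traces *)

Section MatrixUnits.
Variables (K : numClosedFieldType) (A : cstarAlgType K) (I : finType) (V : eqType).
Variables (u : A) (P : V -> A) (c : I -> V) (s : I -> A).

(** The matrix units proper are [s i ** star (s j)] with [c i = c j], one block for each value of
    [c]. For graphs, [i] is a path and [c i] the sink where it ends. *)
Record matrix_units : Prop := MatrixUnits {
  mu_one : is_one u;
  mu_proj : forall v, projection (P v);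
  mu_proj_orth : forall v w, v != w -> P v ** P w = 0;
  mu_end : forall i, s i ** P (c i) = s i;
  mu_orth : forall i j, star (s i) ** s j = if i == j then P (c i) else 0;
  mu_sum : \sum_i s i ** star (s i) = u }.

Hypothesis mu : matrix_units.

Let amul1 a : a ** u = a. Proof. by have [] := mu_one mu a. Qed.
Let PP v : P v ** P v = P v. Proof. by have [] := mu_proj mu v. Qed.
Let starP v : star (P v) = P v. Proof. by have [] := mu_proj mu v. Qed.

(** The scalar is the matrix entry of [a] at [i, j]. As a mere existence statement it can be
    propagated from generators to the closed *-subalgebra that they generate. *)
Definition has_coef (a : A) : Prop :=
  forall i j, exists x, star (s i) ** a ** s j = x *: P (c i).

Lemma mu_split a b i j : star (s i) ** (a ** b) ** s j =
  \sum_l (star (s i) ** a ** s l) ** (star (s l) ** b ** s j).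
Proof.
rewrite -{1}[a]amul1 -(mu_sum mu) !amul_sumr !amul_suml.
by rewrite amul_sumr amul_suml; apply: eq_bigr => l _; rewrite !amulA.
Qed.

(** Right multiplication by [P (c j)] fixes the compression but kills [P (c i)]: entries between
    different blocks vanish. *)
Lemma has_coef_neq a i j x : star (s i) ** a ** s j = x *: P (c i) ->
  c i != c j -> star (s i) ** a ** s j = 0.
Proof.
move=> ax ij; rewrite -(mu_end mu j) amulA ax amulZl (mu_proj_orth mu)//.
by rewrite scaler0.
Qed.

Lemma has_coefM a b : has_coef a -> has_coef b -> has_coef (a ** b).
Proof.
move=> ha hb i j; rewrite mu_split.
pose good l y := (star (s i) ** a ** s l) ** (star (s l) ** b ** s j) = y *: P (c i).
suff /(_ _)/cid-/all_sig[f hf] : forall l, exists y, good l y.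
  exists (\sum_l f l); rewrite scaler_suml; apply: eq_bigr => l _; exact: hf.
move=> l; have [x hx] := ha i l; have [y hy] := hb l j; rewrite /good.
have [il|il] := eqVneq (c i) (c l); last first.
  by exists 0; rewrite (has_coef_neq hx)// amul0l scale0r.
by exists (x * y); rewrite hx hy -il amulZl amulZr PP scalerA.
Qed.

Lemma has_coefD (x : K) a b : has_coef a -> has_coef b -> has_coef (x *: a + b).
Proof.
move=> ha hb i j; have [y hy] := ha i j; have [z hz] := hb i j.
exists (x * y + z); rewrite amulDr amulDl amulZr amulZl hy hz.
by rewrite scalerDl scalerA.
Qed.

Lemma has_coef0 : has_coef 0.
Proof. by move=> i j; exists 0; rewrite amul0r amul0l scale0r. Qed.

Lemma has_coef_star a : has_coef a -> has_coef (star a).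
Proof.
move=> ha i j; have [x hx] := ha j i.
have sx : star (s i) ** star a ** s j = x^* *: P (c j).
  transitivity (star (star (s j) ** a ** s i)); last by rewrite hx starZ starP.
  by rewrite !starM starK amulA.
have [ij|ij] := eqVneq (c j) (c i); first by exists x^*; rewrite sx ij.
exists 0; rewrite scale0r.
transitivity (star (star (s j) ** a ** s i)); last by rewrite (has_coef_neq hx)// star0.
by rewrite !starM starK amulA.
Qed.

Lemma closed_has_coef :
  (forall F : set_system K, ProperFilter F -> cauchy F -> cvg F) ->
  closed has_coef.
Proof.
move=> K_complete.
have -> : has_coef = \bigcap_(ij in [set: I * I])
    (fun a => star (s ij.1) ** a ** s ij.2) @^-1` [set a | exists x, a = x *: P (c ij.1)].
  apply/seteqP; split => [a ha [i j] _|a ha i j]; first exact: ha.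
  exact: (ha (i, j)).
apply: closed_bigI => -[i j] _ /=.
have /continuous_closedP : continuous (fun a => star (s i) ** a ** s j); last first.
  by apply; exact: projection_line_closed (mu_proj mu (c i)).
move=> a; apply: (@continuous_comp _ _ _ (amul (star (s i))) (fun b => b ** s j)).
  exact: amulr_continuous.
exact: amull_continuous.
Qed.

Hypothesis P_neq0 : forall i, P (c i) != 0.
Hypothesis coefP : forall a, has_coef a.

Definition coef (a : A) (i j : I) : K := sval (cid (coefP a i j)).

Lemma coefE a i j : star (s i) ** a ** s j = coef a i j *: P (c i).
Proof. exact: (svalP (cid (coefP a i j))). Qed.

Lemma coef_unique a i j x : star (s i) ** a ** s j = x *: P (c i) ->
  coef a i j = x.
Proof.
rewrite coefE => /eqP; rewrite -subr_eq0 -scalerBl scaler_eq0 (negPf (P_neq0 i)).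
by rewrite orbF subr_eq0 => /eqP.
Qed.

Lemma coef_neq a i j : c i != c j -> coef a i j = 0.
Proof.
by move=> ij; apply: coef_unique; rewrite scale0r (has_coef_neq (coefE a i j)).
Qed.

Lemma coefM a b i j : coef (a ** b) i j = \sum_l coef a i l * coef b l j.
Proof.
apply: coef_unique; rewrite mu_split scaler_suml; apply: eq_bigr => l _.
rewrite !coefE amulZl amulZr scalerA.
have [->|il] := eqVneq (c i) (c l); first by rewrite PP.
by rewrite coef_neq// mul0r !scale0r.
Qed.

Lemma coefD a b i j : coef (a + b) i j = coef a i j + coef b i j.
Proof. by apply: coef_unique; rewrite amulDr amulDl !coefE scalerDl. Qed.

Lemma coef0 i j : coef 0 i j = 0.
Proof. by apply: coef_unique; rewrite amul0r amul0l scale0r. Qed.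

Lemma coef_sum T (r : seq T) (F : T -> A) i j :
  coef (\sum_(t <- r) F t) i j = \sum_(t <- r) coef (F t) i j.
Proof.
exact: (big_morph (fun a => coef a i j) (fun a b => coefD a b i j) (coef0 i j)).
Qed.

Lemma coef_one i : coef u i i = 1.
Proof. by apply: coef_unique; rewrite amul1 (mu_orth mu) eqxx scale1r. Qed.

(** [alpha] acts as conjugation by the diagonal matrix of the z^(d i): apply it to [coefE] and move
    the phases of [s i] and [s j] to the other side. *)
Lemma coef_twist (alpha : A -> A) (z : K) (d : I -> nat) :
    star_hom alpha -> z * z^* = 1 -> (forall i, alpha (s i) = z ^+ d i *: s i) ->
  forall a i j, coef (alpha a) i j = z ^+ d i * z^* ^+ d j * coef a i j.
Proof.
move=> ha zz hs a i j; apply: coef_unique.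
have zzn m : z ^+ m * z^* ^+ m = 1 by rewrite -exprMn zz expr1n.
have alphaP : alpha (P (c i)) = P (c i).
  have <- : star (s i) ** s i = P (c i) by rewrite (mu_orth mu) eqxx.
  rewrite (star_homM ha) (star_hom_star ha) hs starZ amulZl amulZr scalerA.
  by rewrite rmorphXn /= mulrC zzn scale1r.
rewrite -scalerA -alphaP -(star_homZ ha) -coefE !(star_homM ha).
rewrite (star_hom_star ha) !hs starZ rmorphXn /= !(amulZl, amulZr) !scalerA.
set w := (X in _ = X *: _); suff -> : w = 1 by rewrite scale1r.
rewrite -(mulr1 1) -{1}(zzn (d i)) -(zzn (d j)) {}/w.
by move: (z ^+ _) (z^* ^+ _) (z ^+ _) (z^* ^+ _) => x1 x2 x3 x4; ring.
Qed.

(* If [alpha b ** b = 0], the twisted trace [a |-> sum_i z^(- d i) a_ii] kills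
   [b ** b]; hence it kills a unit that is a sum of such squares. *)
Lemma twisted_trace_unit (alpha : A -> A) (z : K) (d : I -> nat) (bs : seq A) v :
    star_hom alpha -> z * z^* = 1 -> (forall i, alpha (s i) = z ^+ d i *: s i) ->
    \sum_(b <- bs) b ** b = u -> (forall b, b \in bs -> alpha b ** b = 0) ->
  \sum_(i | c i == v) z^* ^+ d i = 0.
Proof.
move=> ha zz hs bs1 bs0.
have kill b : alpha b ** b = 0 ->
    \sum_(i | c i == v) z^* ^+ d i * coef (b ** b) i i = 0.
  move=> b0.
  (* Entries between different blocks are 0, so the constraint can be moved from [i] to [j]. *)
  transitivity (\sum_(j | c j == v) \sum_i z^* ^+ d i * (coef b i j * coef b j i)).
    rewrite [RHS]exchange_big [LHS]big_mkcond /=; apply: eq_bigr => i _.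
    rewrite coefM mulr_sumr [RHS]big_mkcond /=; case: eqVneq => iv.
      apply: eq_bigr => j _; case: eqVneq => // jv.
      by rewrite coef_neq ?mul0r ?mulr0// iv eq_sym.
    rewrite big1// => j _; case: eqVneq => // jv.
    by rewrite coef_neq ?mul0r ?mulr0// jv.
  (* Multiplied by the nonzero z^(d j), the inner sum becomes the diagonal entry of [alpha b ** b]
     at [j]. *)
  apply: big1 => j _; apply: (mulfI (_ : z ^+ d j != 0)).
    rewrite expf_neq0//; apply/eqP => z0.
    by move: zz; rewrite z0 mul0r => /eqP; rewrite eq_sym oner_eq0.
  transitivity (coef (alpha b ** b) j j); last by rewrite b0 coef0 mulr0.
  rewrite coefM mulr_sumr; apply: eq_bigr => i _.
  by rewrite (coef_twist ha zz hs); ring.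
transitivity (\sum_(i | c i == v) z^* ^+ d i * coef u i i).
  by apply: eq_bigr => i _; rewrite coef_one mulr1.
transitivity (\sum_(i | c i == v) \sum_(b <- bs) z^* ^+ d i * coef (b ** b) i i).
  by apply: eq_bigr => i _; rewrite -bs1 coef_sum mulr_sumr.
rewrite exchange_big /= big_seq big1// => b /bs0; exact: kill.
Qed.

End MatrixUnits.

(** * Matrix units of the graph algebra *)

Lemma circle_valX (K : numClosedFieldType) (w : circle K) n :
  circle_val (w ^+ n)%g = circle_val w ^+ n.
Proof. by elim: n => [|n IHn] //; rewrite exprS expgS /= IHn. Qed.

(** * Character sums over the k-th roots of unity *)

Section RootsOfUnitySums.
Variables (K : numClosedFieldType) (k : nat).
Hypothesis k_gt0 : (0 < k)%N.

Lemma prim_root_exists : exists zeta : K, k.-primitive_root zeta.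
Proof.
have [r Dp] := closed_field_poly_normal ('X^k - 1 : {poly K}).
rewrite (monicP _) ?monicXnsubC// scale1r in Dp.
have rk1 : all k.-unity_root r by apply/allP => z; rewrite -root_prod_XsubC -Dp.
have sz_r : (k < (size r).+1)%N.
  by rewrite -(size_prod_XsubC r id) -Dp size_XnsubC.
have [|z] := hasP (has_prim_root k_gt0 rk1 _ sz_r); last by exists z.
by rewrite -separable_prod_XsubC -Dp separable_Xn_sub_1// pnatr_eq0 -lt0n.
Qed.

Lemma unity_sum (x : K) : x ^+ k = 1 ->
  \sum_(l < k) x ^+ l = if x == 1 then k%:R else 0.
Proof.
move=> xk; have [->|x1] := eqVneq x 1.
  by under eq_bigr do rewrite expr1n; rewrite sumr_const card_ord.
apply: (mulfI (_ : x - 1 != 0)); first by rewrite subr_eq0.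
by rewrite -subrX1 xk subrr mulr0.
Qed.

Variable zeta : K.
Hypothesis zeta_prim : k.-primitive_root zeta.

Lemma equidistributed (I : finType) (Q : pred I) (d : I -> nat) :
    (forall l, (0 < l < k)%N -> \sum_(i | Q i) (zeta ^+ l) ^+ d i = 0) ->
  forall m m' : 'I_k, #|[pred i | Q i & (d i %% k == m)%N]| =
                      #|[pred i | Q i & (d i %% k == m')%N]|.
Proof.
move=> dl; suff key (m : 'I_k) :
    (#|[pred i | Q i & (d i %% k == m)%N]| * k)%N = #|[pred i | Q i]|.
  by move=> m m'; apply/eqP; rewrite -(eqn_pmul2r k_gt0) !key.
apply/eqP; rewrite -(eqr_nat K) natrM; apply/eqP.
(* [k - m] stands for -m modulo [k]: the sum over [l] is [k] or 0 according to whether [d i] is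
   congruent to [m]. After the exchange of sums only [l = 0] survives, and it counts all of [Q]. *)
transitivity (\sum_(i | Q i) \sum_(l < k) (zeta ^+ (d i + (k - m))) ^+ l).
  rewrite -sum1_card natr_sum mulr_suml (eq_bigl (fun i => Q i && (d i %% k == m)%N)).
    rewrite big_mkcondr /=; apply: eq_bigr => i _; rewrite unity_sum; last first.
      by rewrite exprAC (prim_expr_order zeta_prim) expr1n.
    rewrite -(prim_order_dvd zeta_prim) mul1r -{1}(modn_small (ltn_ord m)).
    rewrite -(eqn_modDr (k - m)%N) subnKC; last exact/ltnW.
    by rewrite modnn.
  by move=> i; rewrite inE.
rewrite exchange_big /= (bigD1 (Ordinal k_gt0))//= [X in _ + X]big1 => [|l l0].
  under eq_bigr do rewrite expr0.
  by rewrite addr0 sumr_const; congr (_ *+ _); exact: eq_card.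
under eq_bigr do rewrite exprAC exprD.
rewrite -mulr_suml dl ?mul0r// ltn_ord andbT lt0n.
by apply: contraNneq l0 => l0; apply/eqP/val_inj.
Qed.

Lemma unity_lift (x : K) : x ^+ k = 1 -> exists z : unity K k, (z : circle K) = x :> K.
Proof.
move=> xk; have x1 : `|x| == 1.
  by rewrite -(@pexpr_eq1 _ _ k)// -normrX xk normr1.
have zk : unity_pred k (Circle x1).
  by apply/eqP/val_inj; rewrite /= circle_valX.
by exists (Unity zk).
Qed.

Lemma unity_expr (z : unity K k) : ((z : circle K) : K) ^+ k = 1.
Proof.
have /eqP/(congr1 (@circle_val K)) : unity_pred k (z : circle K) := valP z.
by rewrite circle_valX.
Qed.

End RootsOfUnitySums.

(** * Matrix units and coefficients in C^*(E) *)

Section GraphMatrixUnits.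
Variables (R : realType) (E : digraph) (A : cstarAlgType (Cplx R)).
Variables (P : vertex E -> A) (S : edge E -> A).
Hypotheses (acE : acyclic E) (gA : is_graph_algebra P S).
Local Notation CK := (graph_algebra_CK gA).

Definition unit_elt : A := \sum_v P v.
Definition sink_end (i : 'I_(size (all_sink_paths E))) := path_end (sink_path i).
Definition sink_elt (i : 'I_(size (all_sink_paths E))) : A :=
  path_elt P S (sink_path i).1 (sink_path i).2.

Let is_path_i i : is_path ((@sink_path E i).1, (sink_path i).2).
Proof. by rewrite -surjective_pairing; have [] := sink_pathP acE i. Qed.

(** The elements fixed by multiplication with [unit_elt] on both sides form a closed *-subalgebra
    containing the generators. *)
Lemma unit_elt_one : is_one unit_elt.
Proof.
have uP v : unit_elt ** P v = P v.
  rewrite amul_suml (bigD1 v)//= (CK_idem CK) big1 ?addr0// => w wv.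
  exact: (CK_proj_orth CK).
have Pu v : P v ** unit_elt = P v.
  rewrite amul_sumr (bigD1 v)//= (CK_idem CK) big1 ?addr0// => w wv.
  by rewrite (CK_proj_orth CK)// eq_sym.
have su : star unit_elt = unit_elt.
  by rewrite star_sum; apply: eq_bigr => v _; rewrite (CK_self_adj CK).
have closed_fix (f : A -> A) : continuous f -> closed [set a | f a = a].
  move=> fc; have -> : [set a | f a = a] = (fun a => f a - a) @^-1` [set 0].
    apply/seteqP; split => a /= [fa]; first by rewrite fa subrr.
    by apply/eqP; rewrite -subr_eq0 fa.
  have /continuous_closedP : continuous (fun a => f a - a).
    by move=> a; apply: cvgB; [exact: fc|exact: cvg_id].
  by apply; apply: accessible_closed_set1; exact/hausdorff_accessible/norm_hausdorff.
pose D := [set a | unit_elt ** a = a] `&` [set a | a ** unit_elt = a].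
suff DT : D = setT by move=> a; have : D a by rewrite DT.
apply: (graph_algebra_generated gA).
- apply: closedI; apply: closed_fix; [exact: amulr_continuous|exact: amull_continuous].
- move=> _ [[v _ <-]|[e _ <-]]; split => //=.
    by rewrite -(CK_PS CK) amulA uP.
  by rewrite -(CK_SP CK) -amulA Pu.
- by split => /=; rewrite ?amul0l ?amul0r.
- move=> c x y [/= ux xu] [/= uy yu]; split => /=.
    by rewrite amulDr amulZr ux uy.
  by rewrite amulDl amulZl xu yu.
- move=> x y [/= ux xu] [/= uy yu]; split => /=.
    by rewrite amulA ux.
  by rewrite -amulA yu.
- move=> x [/= ux xu]; split => /=.
    by rewrite -[X in _ = star X]xu starM su.
  by rewrite -[X in _ = star X]ux starM su.
Qed.

Lemma graph_matrix_units : matrix_units unit_elt P sink_end sink_elt.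
Proof.
split.
- exact: unit_elt_one.
- exact: (CK_proj CK).
- exact: (CK_proj_orth CK).
- by move=> i; rewrite /sink_end [sink_path i]surjective_pairing (path_elt_end CK).
- move=> i j; have [pi si] := sink_pathP acE i; have [pj sj] := sink_pathP acE j.
  rewrite /sink_elt (path_elt_orth CK) -?surjective_pairing//.
  by rewrite (inj_eq (@sink_path_inj E)).
rewrite /unit_elt.
under [RHS]eq_bigr => v _.
  rewrite (path_elt_sum CK (n := #|edge E|)); last by move=> s /(path_size acE).
  over.
rewrite /sink_elt -(big_tnth _ _ _ predT
  (fun p => path_elt P S p.1 p.2 ** star (path_elt P S p.1 p.2))).
by rewrite /all_sink_paths big_allpairs_dep big_enum.
Qed.

(** A generator [P v] or [S e] sends each [sink_elt j] to 0 or to another [sink_elt], so its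
    coefficients are 0 or 1 by orthogonality; generation does the rest. *)
Lemma graph_has_coef a : has_coef P sink_end sink_elt a.
Proof.
have mu := graph_matrix_units.
suff : has_coef P sink_end sink_elt = setT by move=> ->.
have orth i j : exists x, star (sink_elt i) ** sink_elt j = x *: P (sink_end i).
  rewrite (mu_orth mu); case: eqP => _; first by exists 1; rewrite scale1r.
  by exists 0; rewrite scale0r.
have zero i : exists x, star (sink_elt i) ** 0 = x *: P (sink_end i).
  by exists 0; rewrite amul0r scale0r.
apply: (graph_algebra_generated gA).
- exact: (closed_has_coef mu (@Cplx_complete R)).
- move=> _ [[v _ <-]|[e _ <-]] i j; rewrite -amulA {2}/sink_elt.
    by rewrite (path_elt_src CK)//; case: eqP => _; [exact: orth|exact: zero].
  rewrite (path_elt_edge CK)//; case: eqP => [ej|_]; last exact: zero.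
  have [l lE] : exists l, sink_path l = (src e, e :: (sink_path j).2).
    have [pj sj] := sink_pathP acE j; move: pj sj ej.
    case: (sink_path j) => w s /= pj sj ew.
    apply: (sink_path_onto acE); first by rewrite is_path_cons eqxx ew.
    by rewrite /path_end /= ew.
  have -> : path_elt P S (src e) (e :: (sink_path j).2) = sink_elt l.
    by rewrite /sink_elt lE.
  exact: orth.
- exact: has_coef0.
- exact: has_coefD.
- by move=> x y; exact: (has_coefM mu).
- by move=> x; exact: (has_coef_star mu).
Qed.

Lemma gauge_sink_elt (gamma : circle (Cplx R) -> A -> A) z i :
  gauge_action P S gamma ->
  gamma z (sink_elt i) = (z : Cplx R) ^+ size (sink_path i).2 *: sink_elt i.
Proof.
move=> ga; rewrite /sink_elt; have hz := action_hom (gauge_action_action ga) z.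
elim: (sink_path i).2 (sink_path i).1 => [|e s IHs] u /=.
  by rewrite (gauge_vertex ga) expr0 scale1r.
rewrite (star_homM hz) (gauge_edge ga) IHs amulZl amulZr scalerA.
by rewrite exprS.
Qed.

Lemma num_pathsE k v m : sink v -> num_paths k v m =
  #|[pred i | sink_end i == v & (size (sink_path i).2 %% k == m %% k)%N]|.
Proof.
move=> sv; rewrite /num_paths.
have -> : fset_set (paths_mod k v m) = [fset sink_path i | i in
    [pred i | sink_end i == v & (size (sink_path i).2 %% k == m %% k)%N]]%fset.
  apply/fsetP => p; rewrite in_fset_set; last exact: finite_paths_mod.
  apply/idP/imfsetP => [|[i /=]].
    rewrite inE => -[pp pv pm]; have [i ip] : exists i, @sink_path E i = p.
      by apply: (sink_path_onto acE) => //; rewrite pv.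
    by exists i => //; apply/andP; rewrite /sink_end ip pv eqxx pm eqxx.
  rewrite /sink_end => /andP[/eqP iv /eqP im] ->; apply/mem_set.
  by split => //; have [] := sink_pathP acE i.
by rewrite card_imfset; [exact/esym/cardE|exact: sink_path_inj].
Qed.

End GraphMatrixUnits.

(** * Partitions of unity from free actions *)

Lemma continuous_sumr (K : numFieldType) (T : topologicalType) (n : nat)
    (f : nat -> T -> K) :
  (forall l, continuous (f l)) -> continuous (fun x => \sum_(l < n) f l x).
Proof.
move=> fc; elim: n => [|n IHn] x.
  under eq_fun do rewrite big_ord0; exact: cvg_cst.
under eq_fun do rewrite big_ord_recr /=.
by apply: cvgD; [exact: IHn|exact: fc].
Qed.

Lemma continuous_mulr (K : numFieldType) (T : topologicalType) (f g : T -> K) :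
  continuous f -> continuous g -> continuous (fun x => f x * g x).
Proof. by move=> fc gc x; apply: cvgM; [exact: fc|exact: gc]. Qed.

Lemma continuous_exprr (K : numFieldType) (T : topologicalType) (n : nat)
    (f : T -> K) :
  continuous f -> continuous (fun x => f x ^+ n).
Proof.
move=> fc; elim: n => [|n IHn] x.
  under eq_fun do rewrite expr0; exact: cvg_cst.
under eq_fun do rewrite exprS.
by apply: cvgM; [exact: fc|exact: IHn].
Qed.

Lemma cfun_sumE (K : numClosedFieldType) (X : topologicalType) I (r : seq I)
    (F : I -> cfun K X) x :
  (\sum_(i <- r) F i) x = \sum_(i <- r) F i x.
Proof. exact: (big_morph (fun f : cfun K X => f x)). Qed.

Lemma cone_sumE (R : realType) (K : numClosedFieldType) (X : topologicalType)
    I (r : seq I) (F : I -> cone R K X) p :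
  (\sum_(i <- r) F i) p = \sum_(i <- r) F i p.
Proof. exact: (big_morph (fun f : cone R K X => f p)). Qed.

Section UnityDelta.
Variables (K : numClosedFieldType) (k : nat) (zeta : K).
Hypotheses (k_gt0 : (0 < k)%N) (zeta_prim : k.-primitive_root zeta).
Local Notation G := (unity K k).
Local Notation val z := (circle_val (unity_val z)).

Let val_continuous : continuous (fun z : G => val z).
Proof.
move=> z; apply: (@continuous_comp _ _ _ (@unity_val K k) (@circle_val K)).
  exact: unity_val_continuous.
exact: circle_val_continuous.
Qed.

Let delta_continuous (m : nat) :
  continuous (fun z : G => k%:R^-1 * \sum_(l < k) (val z / zeta ^+ m) ^+ l).
Proof.
apply: continuous_mulr; first exact: cst_continuous.
apply: (@continuous_sumr K G k (fun l z => (val z / zeta ^+ m) ^+ l)) => l.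
apply: continuous_exprr; apply: continuous_mulr; last exact: cst_continuous.
exact: val_continuous.
Qed.

(** The indicator function of zeta^m, written as an average of characters so that it is visibly a
    polynomial in [z], hence continuous. *)
Definition delta (m : nat) : cfun K G := mk_cfun (@delta_continuous m).

Let zeta_neq0 m : zeta ^+ m != 0.
Proof.
rewrite expf_neq0//; apply/eqP => z0; have := prim_expr_order zeta_prim.
by rewrite z0 expr0n gtn_eqF// => /esym/eqP; rewrite oner_eq0.
Qed.

Lemma deltaE m z : delta m z = (val z == zeta ^+ m)%:R.
Proof.
rewrite /= unity_sum//; last first.
  by rewrite expr_div_n unity_expr exprAC (prim_expr_order zeta_prim) expr1n divr1.
rewrite -subr_eq0 -(inj_eq (mulIf (zeta_neq0 m))) mul0r mulrBl divfK// mul1r subr_eq0.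
by case: eqP => _; rewrite ?mulr0// mulVf// pnatr_eq0 -lt0n.
Qed.

Lemma delta_sum z : \sum_(m < k) delta m z * delta m z = 1.
Proof.
have [m zm] := prim_rootP zeta_prim (unity_expr z).
under eq_bigr do rewrite deltaE zm.
rewrite (bigD1 m)//= big1 => [|j jm].
  by rewrite eqxx mulr1 addr0.
rewrite (eq_prim_root_expr zeta_prim) !modn_small// eq_sym.
by rewrite (inj_eq val_inj) (negPf jm) mul0r.
Qed.

Lemma delta_free m (g : G) z : g != 1%g -> delta m (z * g)%g * delta m z = 0.
Proof.
move=> g1; rewrite !deltaE /=; case: (eqVneq (val z)) => [zm|]; last by rewrite mulr0.
case: eqP; last by rewrite mul0r.
rewrite zm -{2}[zeta ^+ m]mulr1 => /(mulfI (zeta_neq0 m)) h.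
by case/eqP: g1; do 2 apply: val_inj.
Qed.

End UnityDelta.

Lemma toCplx_sqrtM (R : realType) (x : R) : 0 <= x ->
  toCplx (Num.sqrt x) * toCplx (Num.sqrt x) = toCplx x.
Proof.
by move=> x0; rewrite -[LHS](rmorphM (real_complex R)) /= -expr2 sqr_sqrtr.
Qed.

Lemma toCplx_sqrt_continuous (R : realType) (T : topologicalType) (f : T -> R) :
  continuous f -> continuous (fun x => toCplx (Num.sqrt (f x))).
Proof.
move=> fc x; apply: (@continuous_comp _ _ _ (fun x => Num.sqrt (f x)) (@toCplx R)).
  by apply: (@continuous_comp _ _ _ f Num.sqrt); [exact: fc|exact: sqrt_continuous].
exact: toCplx_continuous.
Qed.

Lemma unitI_bounds (R : realType) (s : unitI R) : 0 <= val s <= 1.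
Proof. by have := valP s; rewrite inE /= in_itv. Qed.

(* A witness of freeness that survives joins and equivariant homomorphisms. *)
Definition free_partition (K : numClosedFieldType) (G : topGroupType)
    (X : rightSpace G) (bs : seq (cfun K X)) : Prop :=
  (forall x, \sum_(b <- bs) b x * b x = 1) /\
  (forall b, b \in bs -> forall g x, g != 1%g -> b (ract x g) * b x = 0).

Section JoinPartition.
Variables (R : realType) (G : topGroupType) (X Y : rightSpace G).
Local Notation K := (Cplx R).
Local Notation T := (X * Y * unitI R)%type.
Local Open Scope quotient_scope.

Lemma join_lift (f : T -> K) : continuous f ->
    (forall p q : T, \pi_(join R X Y) p == \pi_(join R X Y) q -> f p = f q) ->
  exists F : cfun K (join_space R X Y), forall p : T, F (\pi_(join R X Y) p) = f p.
Proof.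
move=> fc fq.
have Fc : continuous (fun q : join_space R X Y => f (repr (q : join R X Y))).
  apply: (@repr_comp_continuous _ {eq_quot (@join_rel R G X Y)} _ f) => //.
  by move=> p q pq; apply/eqP/fq.
by exists (mk_cfun Fc) => p /=; apply: fq; rewrite reprK.
Qed.

Lemma join_eqP (p q : T) : \pi_(join R X Y) p == \pi_(join R X Y) q ->
  [/\ p.2 = q.2, val p.2 = 1 \/ p.1.1 = q.1.1 & val p.2 = 0 \/ p.1.2 = q.1.2].
Proof.
move=> /eqP/(@eqmodP _ (join_equiv R X Y))/and3P[/eqP pq hx hy]; split => //.
  by case/orP: hx => /eqP; [left|right].
by case/orP: hy => /eqP; [left|right].
Qed.

Let snd_continuous : continuous (fun p : T => val p.2).
Proof.
move=> p; apply: (@continuous_comp _ _ _ snd (val : unitI R -> R)).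
  exact: cvg_snd.
exact: initial_continuous.
Qed.

(** The weight vanishes at the end [s = 1], where the join forgets the coordinate in [X], so the
    product descends to the quotient. Its square and that of the weight in [join_right] add up to
    1. *)
Lemma join_left (b : cfun K X) : exists F : cfun K (join_space R X Y),
  forall p : T, F (\pi_(join R X Y) p) = toCplx (Num.sqrt (1 - val p.2)) * b p.1.1.
Proof.
apply: join_lift => [|p q /join_eqP[<- [->|->] _] //]; last first.
  by rewrite subrr sqrtr0 /toCplx raddf0 !mul0r.
apply: continuous_mulr.
  apply: toCplx_sqrt_continuous => p; apply: cvgB; first exact: cvg_cst.
  exact: snd_continuous.
move=> p; apply: (@continuous_comp _ _ _ (fun p : T => p.1.1) b).
  by apply: (@continuous_comp _ _ _ fst fst); exact: cvg_fst.
exact: cfunP.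
Qed.

Lemma join_right (b : cfun K Y) : exists F : cfun K (join_space R X Y),
  forall p : T, F (\pi_(join R X Y) p) = toCplx (Num.sqrt (val p.2)) * b p.1.2.
Proof.
apply: join_lift => [|p q /join_eqP[<- _ [->|->]] //]; last first.
  by rewrite sqrtr0 /toCplx raddf0 !mul0r.
apply: continuous_mulr; first exact: toCplx_sqrt_continuous.
move=> p; apply: (@continuous_comp _ _ _ (fun p : T => p.1.2) b).
  by apply: (@continuous_comp _ _ _ fst snd); [exact: cvg_fst|exact: cvg_snd].
exact: cfunP.
Qed.

(** The action leaves the join parameter unchanged, so the weights factor out of
    [b (ract x g) * b x]. *)
Lemma free_partition_join (bs : seq (cfun K X)) (cs : seq (cfun K Y)) :
    free_partition bs -> free_partition cs ->
  exists ds : seq (cfun K (join_space R X Y)), free_partition ds.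
Proof.
move=> [bs1 bs0] [cs1 cs0].
pose jl b := sval (cid (join_left b)); pose jr c := sval (cid (join_right c)).
have jlE b p : jl b (\pi_(join R X Y) p) = _ := svalP (cid (join_left b)) p.
have jrE c p : jr c (\pi_(join R X Y) p) = _ := svalP (cid (join_right c)) p.
exists (map jl bs ++ map jr cs); split => [x|d].
  rewrite big_cat !big_map /= -[x in X in X = _](@reprK _ (join R X Y)).
  set p := repr _.
  under eq_bigr do rewrite jlE mulrACA.
  under [X in _ + X]eq_bigr do rewrite jrE mulrACA.
  have /andP[p0 p1] := unitI_bounds p.2.
  rewrite -!mulr_sumr bs1 cs1 !mulr1 !toCplx_sqrtM ?subr_ge0//.
  by rewrite -[LHS](rmorphD (real_complex R)) subrK.
move=> d_in g x g1.
have -> : ract x g = \pi_(join R X Y) (join_act0 (repr (x : join R X Y)) g) by [].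
rewrite -{2}[x](@reprK _ (join R X Y)); set p := repr _.
move: d_in; rewrite mem_cat => /orP[/mapP[b /bs0 b0 ->]|/mapP[c /cs0 c0 ->]].
  by rewrite !jlE mulrACA b0 ?mulr0.
by rewrite !jrE mulrACA c0 ?mulr0.
Qed.

End JoinPartition.

Section UnityPartitions.
Variables (R : realType) (k : nat).
Hypothesis k_gt0 : (0 < k)%N.
Local Notation K := (Cplx R).
Local Notation G := (unity K k).

Lemma free_partition_unity :
  exists bs : seq (cfun K (translation_space G)), free_partition bs.
Proof.
have [zeta zP] := prim_root_exists K k_gt0.
exists [seq delta k zeta (val m) | m : 'I_k <- enum 'I_k]; split=> [x|_ /mapP[m _ ->] g x g1].
  by rewrite big_map big_enum; exact: delta_sum.
exact: delta_free.
Qed.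

Lemma free_partition_EG n : exists bs : seq (cfun K (EG R G n)), free_partition bs.
Proof.
have [cs hcs] := free_partition_unity.
elim: n => [|n [bs hbs]]; first by exists cs.
exact: free_partition_join hbs hcs.
Qed.

Variables (A : cstarAlgType K) (alpha : G -> A -> A).

Lemma SLT_partition n : SLT_bound alpha n ->
  exists bs : seq A, is_one (\sum_(b <- bs) b ** b) /\
    forall b, b \in bs -> forall g, g != 1%g -> alpha g b ** b = 0.
Proof.
move=> [phi [hphi phia phi1]]; have [bs [bs1 bs0]] := free_partition_EG n.
exists (map phi bs); split=> [|_ /mapP[b /bs0 b0 ->] g g1].
  rewrite big_map; under eq_bigr do rewrite -(star_homM hphi).
  rewrite -(star_hom_sum hphi); suff -> : \sum_(b <- bs) b ** b = cfun1 K _ by [].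
  by apply: cfun_eqP => x; rewrite cfun_sumE; exact: bs1.
rewrite -phia -(star_homM hphi) -[RHS](star_hom0 hphi); congr phi.
by apply: cfun_eqP => x; exact: b0.
Qed.

Let cone_root_continuous (b : cfun K G) :
  continuous (fun p : unitI R * G => toCplx (Num.sqrt (val p.1)) * b p.2).
Proof.
apply: continuous_mulr.
  apply: toCplx_sqrt_continuous => p.
  apply: (@continuous_comp _ _ _ fst (val : unitI R -> R)).
    exact: cvg_fst.
  exact: initial_continuous.
move=> p; apply: (@continuous_comp _ _ _ snd b); first exact: cvg_snd.
exact: cfunP.
Qed.

Let cone_root_vanish (b : cfun K G) s x :
  val s = 0 -> mk_cfun (@cone_root_continuous b) (s, x) = 0.
Proof. by move=> s0; rewrite /= s0 sqrtr0 /toCplx raddf0 mul0r. Qed.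

(* sqrt t (x) b *)
Definition cone_root (b : cfun K G) : cone R K G := mk_cone (@cone_root_vanish b).

(** The squares of the sqrt t (x) b add up to t (x) 1 over the partition, and the images of t (x) 1
    under the [rho i] add up to the unit. *)
Lemma LT_partition n : LT_bound alpha n ->
  exists bs : seq A, is_one (\sum_(b <- bs) b ** b) /\
    forall b, b \in bs -> forall g, g != 1%g -> alpha g b ** b = 0.
Proof.
move=> [rho [hrho rhoa rho1]]; have [bs [bs1 bs0]] := free_partition_unity.
exists [seq rho i (cone_root b) | i <- enum 'I_n.+1, b <- bs].
split=> [|_ /allpairsP[[i b] [_ /bs0 b0 ->]] g g1] /=.
  rewrite big_allpairs_dep big_enum /=.
  suff -> : \sum_(i < n.+1) \sum_(b <- bs) rho i (cone_root b) ** rho i (cone_root b) =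
     \sum_(i < n.+1) rho i (cone_t R G) by [].
  apply: eq_bigr => i _; under eq_bigr do rewrite -(star_homM (hrho i)).
  rewrite -(star_hom_sum (hrho i)); congr (rho i _).
  apply/val_inj/cfun_eqP => -[s x]; rewrite cone_sumE.
  transitivity (\sum_(b <- bs) toCplx (val s) * (b x * b x)).
    apply: eq_bigr => b _ /=; rewrite mulrACA toCplx_sqrtM//.
    by have /andP[] := unitI_bounds s.
  by rewrite -mulr_sumr bs1 mulr1.
rewrite -rhoa -(star_homM (hrho i)) -[RHS](star_hom0 (hrho i)); congr (rho i _).
apply/val_inj/cfun_eqP => -[s x] /=.
by rewrite mulrACA b0 ?mulr0.
Qed.

End UnityPartitions.

(** * The cyclic shift *)

Lemma periodic_sum (V : zmodType) (k : nat) (f : nat -> V) (l : nat) :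
  (forall j, f (j + k)%N = f j) -> \sum_(j < k) f (j + l)%N = \sum_(j < k) f j.
Proof.
move=> fk; elim: l => [|l <-]; first by under eq_bigr do rewrite addn0.
case: k fk => [|k] fk; first by rewrite !big_ord0.
rewrite big_ord_recr [RHS]big_ord_recl /= addrC; congr (_ + _).
  by rewrite addnS -addSn addnC fk.
by apply: eq_bigr => j _; rewrite addnS.
Qed.

Section CyclicShift.
Variables (I : finType) (V : eqType) (c : I -> V) (d : I -> nat) (k : nat).
Hypothesis k_gt0 : (0 < k)%N.

Definition fiber (v : V) (m : nat) : seq I :=
  enum [pred i | c i == v & (d i %% k == m)%N].

Hypothesis fiber_size : forall i (m m' : 'I_k),
  size (fiber (c i) m) = size (fiber (c i) m').

Lemma mem_fiber v m i : (i \in fiber v m) = (c i == v) && (d i %% k == m)%N.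
Proof. by rewrite mem_enum. Qed.

(* The shift moves [i] to the element of the same rank in the fiber [j] further. *)
Definition shift (j : nat) (i : I) : I :=
  nth i (fiber (c i) ((d i + j) %% k)) (index i (fiber (c i) (d i %% k))).

(** Here the equal fiber sizes enter: the rank of [i] is valid in every fiber of its class, so [nth]
    never returns its default. *)
Let index_lt i j :
  (index i (fiber (c i) (d i %% k)) < size (fiber (c i) ((d i + j) %% k)))%N.
Proof.
have lt n : (n %% k < k)%N by rewrite ltn_mod.
rewrite (fiber_size i (Ordinal (lt (d i + j)%N)) (Ordinal (lt (d i)))).
by rewrite index_mem mem_fiber !eqxx.
Qed.

Lemma shift_in j i : shift j i \in fiber (c i) ((d i + j) %% k).
Proof. exact: mem_nth (index_lt i j). Qed.

Lemma shift_class j i : c (shift j i) = c i.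
Proof. by have := shift_in j i; rewrite mem_fiber => /andP[/eqP]. Qed.

Lemma shift_degree j i : d (shift j i) = d i + j %[mod k].
Proof. by have := shift_in j i; rewrite mem_fiber => /andP[_ /eqP]. Qed.

Lemma shift0 i : shift 0 i = i.
Proof. by rewrite /shift addn0 nth_index// mem_fiber !eqxx. Qed.

Lemma shift_period j i : shift (j + k) i = shift j i.
Proof. by rewrite /shift addnA modnDr. Qed.

(** A shift preserves the rank inside the fiber, so only the total displacement matters. *)
Lemma shiftD j l i : shift j (shift l i) = shift (l + j) i.
Proof.
have dE : (d (shift l i) + j = d i + (l + j) %[mod k])%N.
  by rewrite -modnDml shift_degree modnDml addnA.
have idx : index (shift l i) (fiber (c i) ((d i + l) %% k)) =
    index i (fiber (c i) (d i %% k)).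
  by apply: index_uniq; [exact: index_lt|exact: enum_uniq].
rewrite [LHS]/shift shift_class shift_degree dE idx.
(* The two sides differ only in the default of [nth]. *)
by apply: set_nth_default; exact: index_lt.
Qed.

Lemma shift_inj j : injective (shift j).
Proof.
move=> i i' ii'; rewrite -(shift0 i) -(shift0 i').
(* A further shift by [k - j %% k] completes a multiple of [k], hence undoes the shift by [j]. *)
have kj : (j + (k - j %% k) = (j %/ k).+1 * k)%N.
  rewrite {1}(divn_eq j k) -addnA subnKC ?mulSn ?[(k + _)%N]addnC//.
  by rewrite ltnW// ltn_mod.
have period n i0 : shift (n * k) i0 = shift 0 i0.
  by elim: n => [|n IHn] //; rewrite mulSn addnC shift_period.
by rewrite -(period (j %/ k).+1 i) -(period (j %/ k).+1 i') -kj -!shiftD ii'.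
Qed.

Variables (K : numClosedFieldType) (A : cstarAlgType K).
Variables (u : A) (P : V -> A) (s : I -> A) (zeta : K).
Hypothesis mu : matrix_units u P c s.
Hypothesis zeta_prim : k.-primitive_root zeta.

Let mul1 a : u ** a = a. Proof. by have [] := mu_one mu a. Qed.

(** The permutation unitary of [shift j], which is the j-th power of W in explicit form. *)
Definition shift_elt (j : nat) : A := \sum_i s (shift j i) ** star (s i).
Local Notation W := shift_elt.

Lemma shift_elt0 : W 0 = u.
Proof.
by rewrite -(mu_sum mu); apply: eq_bigr => i _; rewrite shift0.
Qed.

Lemma shift_elt_period j : W (j + k) = W j.
Proof. by apply: eq_bigr => i _; rewrite shift_period. Qed.

Lemma shift_eltD j l : W j ** W l = W (l + j).
Proof.
rewrite {1}/shift_elt amul_suml.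
transitivity (\sum_i \sum_i' s (shift j i) ** (star (s i) ** s (shift l i')) ** star (s i')).
  by apply: eq_bigr => i _; rewrite amul_sumr; apply: eq_bigr => i' _; rewrite !amulA.
rewrite exchange_big /=; apply: eq_bigr => i' _.
rewrite (bigD1 (shift l i'))//= big1 => [|i ii']; last first.
  by rewrite (mu_orth mu) (negPf ii') amul0r amul0l.
rewrite (mu_orth mu) eqxx addr0 -(shift_class j) (mu_end mu).
by rewrite shiftD.
Qed.

Lemma shift_elt_isometry j : star (W j) ** W j = u.
Proof.
rewrite star_sum amul_suml -(mu_sum mu).
transitivity (\sum_i \sum_i' s i ** (star (s (shift j i)) ** s (shift j i')) ** star (s i')).
  apply: eq_bigr => i _; rewrite amul_sumr; apply: eq_bigr => i' _.
  by rewrite starM starK !amulA.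
apply: eq_bigr => i _; rewrite (bigD1 i)//= big1 => [|i' ii']; last first.
  rewrite (mu_orth mu) (inj_eq (@shift_inj j)) eq_sym (negPf ii').
  by rewrite amul0r amul0l.
by rewrite (mu_orth mu) eqxx addr0 shift_class (mu_end mu).
Qed.

(** The spectral projection of [W 1] at the eigenvalue [x], obtained by averaging over its
    powers. *)
Definition spectral_proj (x : K) : A := k%:R^-1 *: \sum_(j < k) x^* ^+ j *: W j.
Local Notation q := spectral_proj.

Let k_neq0 : k%:R != 0 :> K. Proof. by rewrite pnatr_eq0 -lt0n. Qed.

Let conj_unity (x : K) : x ^+ k = 1 -> x^* ^+ k = 1 /\ x * x^* = 1.
Proof.
move=> xk; split; first by rewrite -rmorphXn xk rmorph1.
rewrite -normCK; have -> : `|x| = 1; last by rewrite expr1n.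
by apply/eqP; rewrite -(@pexpr_eq1 _ _ k)// -normrX xk normr1.
Qed.

Lemma shift_spectral x l : x ^+ k = 1 -> W l ** q x = x ^+ l *: q x.
Proof.
move=> /conj_unity[xk xx]; rewrite amulZr amul_sumr scalerA mulrC -scalerA.
congr (_ *: _); rewrite scaler_sumr -(@periodic_sum _ k (fun j => x ^+ l *: (x^* ^+ j *: W j)) l).
  apply: eq_bigr => j _; rewrite amulZr shift_eltD scalerA exprD mulrCA.
  by rewrite -exprMn xx expr1n mulr1.
by move=> j; rewrite shift_elt_period exprD xk mulr1.
Qed.

Lemma spectral_orth x y : x ^+ k = 1 -> y ^+ k = 1 ->
  q x ** q y = if x == y then q y else 0.
Proof.
move=> xk yk; have [xk' xx] := conj_unity xk.
rewrite {1}/spectral_proj amulZl amul_suml.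
under eq_bigr do rewrite amulZl (shift_spectral _ yk) scalerA -exprMn.
rewrite -scaler_suml unity_sum//; last by rewrite exprMn xk' yk mulr1.
have -> : (x^* * y == 1) = (x == y).
  rewrite -(inj_eq (mulfI (_ : x != 0))); last first.
    by apply: contraNneq (oner_neq0 K) => x0; rewrite -xx x0 mul0r.
  by rewrite mulrA xx mul1r mulr1 eq_sym.
by case: eqP => _; rewrite ?scale0r ?scaler0// scalerA mulVf// scale1r.
Qed.

(** Since [W j] is an isometry acting on [q x] as x^j, each term of [star (q x) ** q x] gives [q x];
    so [q x] has the form [star a ** a]. *)
Lemma spectral_self_adj x : x ^+ k = 1 -> star (q x) = q x.
Proof.
move=> xk; have [xk' xx] := conj_unity xk.
suff e : star (q x) ** q x = q x by rewrite -[in LHS]e starM starK e.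
rewrite {1}/spectral_proj starZ star_sum amulZl amul_suml.
have -> : \sum_(j < k) star (x^* ^+ j *: W j) ** q x = \sum_(j < k) q x.
  apply: eq_bigr => j _.
  rewrite starZ rmorphXn /= conjCK amulZl -amulZr -shift_spectral//.
  by rewrite amulA shift_elt_isometry mul1.
by rewrite sumr_const card_ord -[q x *+ k]scaler_nat fmorphV rmorph_nat scalerK.
Qed.

Lemma spectral_sum : \sum_(m < k) q (zeta ^+ m) = u.
Proof.
rewrite -scaler_sumr exchange_big /=.
transitivity (k%:R^-1 *: \sum_(j < k) (if j == 0%N :> nat then k%:R else 0) *: W j).
  congr (_ *: _); apply: eq_bigr => j _; rewrite -scaler_suml; congr (_ *: _).
  under eq_bigr do rewrite rmorphXn /= exprAC.
  have [zk _] := conj_unity (prim_expr_order zeta_prim).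
  rewrite unity_sum; last by rewrite exprAC zk expr1n.
  rewrite -rmorphXn fmorph_eq1.
  rewrite -(prim_order_dvd zeta_prim) /dvdn modn_small//.
rewrite (bigD1 (Ordinal k_gt0))//= big1 => [|j j0].
  by rewrite addr0 scalerA mulVf// scale1r shift_elt0.
by rewrite (_ : (j == 0%N :> nat) = false) ?scale0r//; apply/negbTE.
Qed.

(** [shift j] raises degrees by [j] modulo [k], so [alpha] multiplies [W j] by z^j; this phase is
    absorbed into [x]. *)
Lemma spectral_twist (alpha : A -> A) (z x : K) :
    star_hom alpha -> (forall i, alpha (s i) = z ^+ d i *: s i) -> z ^+ k = 1 ->
  alpha (q x) = q (x * z^*).
Proof.
move=> ha hs zk; have [zk' zz] := conj_unity zk.
rewrite (star_homZ ha) (star_hom_sum ha); congr (_ *: _).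
apply: eq_bigr => j _; rewrite (star_homZ ha) rmorphM /= conjCK exprMn -scalerA.
congr (_ *: _); rewrite (star_hom_sum ha) scaler_sumr; apply: eq_bigr => i _.
rewrite (star_homM ha) (star_hom_star ha) !hs starZ amulZl amulZr scalerA.
congr (_ *: _); rewrite rmorphXn /= -(expr_mod (d (shift j i)) zk) shift_degree.
rewrite expr_mod// exprD mulrC mulrA -exprMn [z^* * z]mulrC zz expr1n mul1r.
by [].
Qed.

Variable alpha : unity K k -> A -> A.
Hypothesis alpha_hom : forall z, star_hom (alpha z).
Hypothesis alphaE : forall z i, alpha z (s i) = circle_val z ^+ d i *: s i.

(* Functional calculus for the unitary [W 1], whose spectrum consists of k-th
   roots of unity. *)
Lemma equivariant_functions_hom :
  exists phi : cfun K (translation_space (unity K k)) -> A,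
    [/\ star_hom phi, forall g f, phi (translate g f) = alpha g (phi f)
      & is_one (phi (cfun1 K (translation_space (unity K k))))].
Proof.
have zk m : (zeta ^+ m) ^+ k = 1.
  by rewrite exprAC (prim_expr_order zeta_prim) expr1n.
pose g m : unity K k := sval (cid (unity_lift k_gt0 (zk m))).
have gE m : circle_val (g m) = zeta ^+ m := svalP (cid (unity_lift k_gt0 (zk m))).
have valI (x y : unity K k) : circle_val x = circle_val y -> x = y.
  by move=> xy; do 2 apply: val_inj.
pose phi (f : cfun K (translation_space (unity K k))) : A :=
  \sum_(m < k) f (g m) *: q (zeta ^+ m).
have orth (m m' : 'I_k) : q (zeta ^+ m) ** q (zeta ^+ m') =
    if m == m' then q (zeta ^+ m') else 0.
  rewrite spectral_orth// (eq_prim_root_expr zeta_prim) !modn_small//.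
exists phi; split; first split.
- move=> a f h; rewrite /phi scaler_sumr -big_split; apply: eq_bigr => m _.
  by rewrite cfun_linE scalerDl -scalerA.
- move=> f h; rewrite /phi amul_suml; apply: eq_bigr => m _.
  rewrite amul_sumr (bigD1 m)//= big1 => [|m' m'm].
    by rewrite addr0 amulZl amulZr orth eqxx -scalerA.
  by rewrite amulZl amulZr orth eq_sym (negPf m'm) !scaler0.
- move=> f; rewrite /phi star_sum; apply: eq_bigr => m _.
  by rewrite starZ spectral_self_adj.
- move=> z f; rewrite /phi (star_hom_sum (alpha_hom z)).
  have [l zl] := prim_rootP zeta_prim (unity_expr z).
  have zz : zeta ^+ l * (zeta ^+ l)^* = 1.
    by have [] := conj_unity (zk l).
  (* With z = zeta^l, translation moves the point [g m] to [g (m + l)] while [alpha z] lowers the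
     spectral index by [l]; reindexing by [l] matches the two. *)
  rewrite -(@periodic_sum _ k (fun m => alpha z (f (g m) *: q (zeta ^+ m))) l).
    apply: eq_bigr => m _; rewrite (star_homZ (alpha_hom z)).
    rewrite (spectral_twist (zeta ^+ (m + l)) (alpha_hom z) (alphaE z) (unity_expr z)).
    rewrite zl exprD -mulrA zz mulr1 /=; congr (f _ *: _).
    by apply: valI; rewrite gE /= gE zl exprD.
  move=> j; have zp : zeta ^+ (j + k) = zeta ^+ j.
    by rewrite exprD (prim_expr_order zeta_prim) mulr1.
  by rewrite zp; congr (alpha z (f _ *: _)); apply: valI; rewrite !gE.
have -> : phi (cfun1 K (translation_space (unity K k))) = u.
  by rewrite -spectral_sum; apply: eq_bigr => m _; rewrite /= scale1r.
exact: (mu_one mu).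
Qed.

End CyclicShift.

(** * The equivalences *)

Lemma least_neq_None (P : nat -> Prop) : least P <> None <-> exists n, P n.
Proof.
rewrite /least; case: pselect => [exP|nP]; split => //.
  by move=> _; have [n /asboolP Pn] := exP; exists n.
by move=> [n Pn]; case: nP; exists n; exact/asboolP.
Qed.

Lemma least_Some0 (P : nat -> Prop) : P 0%N -> least P = Some 0%N.
Proof.
move=> P0; rewrite /least; case: pselect => [exP|[]]; last first.
  by exists 0%N; exact/asboolP.
case: ex_minnP => n _ n_min; congr Some; apply/eqP; rewrite -leqn0.
by apply: n_min; exact/asboolP.
Qed.

Lemma is_one_unique (K : numClosedFieldType) (A : starAlgType K) (u v : A) :
  is_one u -> is_one v -> u = v.
Proof. by move=> u1 v1; rewrite -(u1 v).1 (v1 u).2. Qed.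

Section Equivalences.
Variables (R : realType) (E : digraph) (k : nat) (A : cstarAlgType (Cplx R)).
Variables (P : vertex E -> A) (S : edge E -> A) (gamma : circle (Cplx R) -> A -> A).
Hypotheses (acE : acyclic E) (k_gt0 : (0 < k)%N).
Hypotheses (gA : is_graph_algebra P S) (ga : gauge_action P S gamma).
Local Notation alpha := (restrict_unity gamma (k := k)).

Lemma partition_counts (bs : seq A) :
    is_one (\sum_(b <- bs) b ** b) ->
    (forall b, b \in bs -> forall g, g != 1%g -> alpha g b ** b = 0) ->
  forall v : vertex E, sink v ->
    forall i j : 'I_k, num_paths k v i = num_paths k v j.
Proof.
move=> bs1 bs0 v sv i j; rewrite !(num_pathsE acE)// !modn_small//.
have [zeta zP] := prim_root_exists (Cplx R) k_gt0.
apply: (equidistributed k_gt0 zP (Q := fun i => sink_end i == v)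
  (d := fun i => size (sink_path i).2)) => l /andP[l0 lk].
(* The twisted trace involves the conjugate of [z], so [z] is chosen as the conjugate of zeta^l. *)
have zlk : ((zeta ^+ l)^*) ^+ k = 1.
  by rewrite -rmorphXn exprAC (prim_expr_order zP) expr1n rmorph1.
have [z zE] := unity_lift k_gt0 zlk.
have zz : circle_val z * (circle_val z)^* = 1.
  by rewrite -normCK circle_norm expr1n.
have z1 : z != 1%g.
  apply/eqP => z1; move: zE; rewrite z1 => /esym/eqP; rewrite fmorph_eq1.
  by rewrite -(prim_order_dvd zP) /dvdn modn_small// gtn_eqF.
have P_neq0 i' : P (@sink_end E i') != 0.
  by apply: (sink_proj_neq0 acE gA); have [] := sink_pathP acE i'.
have := twisted_trace_unit (graph_matrix_units acE gA) P_neq0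
  (graph_has_coef acE gA) v (action_hom (gauge_action_action ga) z) zz
  (fun i => gauge_sink_elt z i ga)
  (is_one_unique bs1 (unit_elt_one gA)) (fun b bb => bs0 b bb z z1).
by under eq_bigr do rewrite zE conjCK.
Qed.

Lemma counts_SLT0 :
    (forall v : vertex E, sink v ->
      forall i j : 'I_k, num_paths k v i = num_paths k v j) ->
  SLT_bound alpha 0.
Proof.
move=> cst; have [zeta zP] := prim_root_exists (Cplx R) k_gt0.
apply: (equivariant_functions_hom k_gt0 _ (graph_matrix_units acE gA) zP
  (d := fun i => size (sink_path i).2)).
- move=> i m m'; have [_ si] := sink_pathP acE i.
  have := cst _ si m m'; rewrite !(num_pathsE acE)// !modn_small//.
  by rewrite /fiber -!cardE.
- by move=> z; exact: (action_hom (gauge_action_action ga)).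
- by move=> z i; exact: gauge_sink_elt.
Qed.

(** Evaluation at t = 1 maps the cone equivariantly to C(G) and takes t (x) 1 to 1. *)
Lemma SLT0_LT0 : SLT_bound alpha 0 -> LT_bound alpha 0.
Proof.
move=> [phi [hphi phia phi1]].
have one_in : (1 : R) \in `[0 : R, 1] by rewrite in_itv /= ler01 lexx.
pose s1 : unitI R := SigSub (mem_set one_in : 1 \in [set` `[0 : R, 1]]).
have ev_cont (f : cone R (Cplx R) (unity (Cplx R) k)) :
    continuous (fun x : unity (Cplx R) k => f (s1, x)).
  move=> x; apply: (@continuous_comp _ _ _ (fun x : unity (Cplx R) k => (s1, x)) f).
    by apply: pair_fun_continuous => y; [exact: cst_continuous|exact: cvg_id].
  exact: cfunP.
pose ev f : cfun (Cplx R) (EG R (unity (Cplx R) k) 0) := mk_cfun (@ev_cont f).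
have hev : star_hom ev by split=> [a f h|f h|f]; apply: cfun_eqP => x.
exists (fun _ => phi \o ev); split=> [_|_ g f|].
- exact: star_hom_comp.
- by rewrite /= -phia; congr phi; apply: cfun_eqP => x.
rewrite big_ord1 /=; suff -> : ev (cone_t R _) = cfun1 _ _ by [].
by apply: cfun_eqP => x.
Qed.

End Equivalences.

Theorem theorem4p4 (R : realType) (E : digraph) (k : nat)
    (A : cstarAlgType (Cplx R)) (P : vertex E -> A) (S : edge E -> A)
    (gamma : circle (Cplx R) -> A -> A) :
  acyclic E -> (0 < k)%N ->
  is_graph_algebra P S -> gauge_action P S gamma ->
  [<-> dimSLT (restrict_unity gamma (k := k)) <> None;
       dimLT (restrict_unity gamma (k := k)) <> None;
       (forall v : vertex E, sink v ->
          forall i j : 'I_k, num_paths k v i = num_paths k v j);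
       dimLT (restrict_unity gamma (k := k)) = Some 0%N].
Proof.
move=> acE k_gt0 gA ga; rewrite /dimSLT /dimLT; tfae.
- move=> /least_neq_None[n /(SLT_partition k_gt0)[bs [bs1 bs0]]].
  apply/least_neq_None; exists 0%N.
  exact/SLT0_LT0/(counts_SLT0 acE k_gt0 gA ga)/(partition_counts acE k_gt0 gA ga bs1).
- move=> /least_neq_None[n /(LT_partition k_gt0)[bs [bs1 bs0]]].
  exact: (partition_counts acE k_gt0 gA ga bs1).
- by move=> cst; apply/least_Some0/SLT0_LT0/(counts_SLT0 acE k_gt0 gA ga).
move=> LT0; have /least_neq_None[n /(LT_partition k_gt0)[bs [bs1 bs0]]] :
  least (LT_bound (restrict_unity gamma (k := k))) <> None by rewrite LT0.
apply/least_neq_None; exists 0%N; apply: (counts_SLT0 acE k_gt0 gA ga).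
exact: (partition_counts acE k_gt0 gA ga bs1).
Qed.
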